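(* Let $(M,g)$ be a Riemannian $n$-manifold, $1\le r\le n-1$, $\Omega\subset M$ open, $u:\Omega\to\mathbb{R}$ a $C^2$ function, and $G=\{(p,u(p)):p\in\Omega\}$ its vertical graph in $M\times\mathbb{R}$. The $(r+1)$-mean curvature $H_{r+1}$ of $G$ is given by $$(r+1)S_{r+1}=(r+1)\binom{n}{r+1}H_{r+1}=\mathrm{div}_g\left(P_r\frac{\nabla_g u}{W}\right)+J_r\left(\frac{\nabla_g u}{W},\frac{\nabla_g u}{W}\right),$$ where $\mathrm{div}_g$ is the divergence in $M$.
   Context: $M\times\mathbb{R}$ carries the product metric $g+dt^2$; $\nabla_g$ and $\nabla^g$ are the gradient and Levi-Civita connection of $(M,g)$, and $W=\sqrt{1+|\nabla_g u|_g^2}$. The graph $G$ is oriented by the upward unit normal $N=\left(-\frac{\nabla_g u}{W},\frac1W\right)$; its shape operator, viewed as an endomorphism of $TM$ (via the projection $G\to\Omega$), is $A(v)=\nabla^g_v\left(\frac{\nabla_g u}{W}\right)$. $S_r$ is the $r$-th elementary symmetric function of the eigenvalues $k_1,\ldots,k_n$ of $A$ (the principal curvatures), and $H_r=S_r/\binom nr$. The Newton tensors are $P_0=I$, $P_r=S_rI-A\circ P_{r-1}$. The curvature tensor has the sign convention $R_g(X,Y)Z=\nabla^g_Y\nabla^g_XZ-\nabla^g_X\nabla^g_YZ+\nabla^g_{[X,Y]}Z$, so that $Ric_g(v_1,v_2)=\mathrm{trace}(z\mapsto R_g(v_1,z)v_2)$ is the usual Ricci tensor. Set $\tau_r(v_1,v_2)=\mathrm{trace}\left(z\mapsto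 P_{r-1}R_g(v_1,z)v_2\right)$ and define inductively $J_1(v_1,v_2)=\tau_1(v_1,v_2)=Ric_g(v_1,v_2)$ and $J_s(v_1,v_2)=\tau_s(v_1,v_2)-J_{s-1}(Av_1,v_2)$.
   Formalization: For u only C^2 the field P_r(∇u/W) is merely continuous and its divergence need not exist; the identity is asserted at each point of Ω where this field is differentiable (every point if u is C^3). *)

(* Defs.v *)
From HB Require Import structures.
From mathcomp Require Import all_boot all_order all_algebra.
From mathcomp Require Import all_classical all_reals all_analysis.
Set Implicit Arguments.
Unset Strict Implicit.
Unset Printing Implicit Defensive.
Import Order.TTheory GRing.Theory Num.Theory.
Import numFieldNormedType.Exports.
Local Open Scope classical_set_scope.
Local Open Scope ring_scope.

(* Conventions: the coordinates of a point are a row vector 'rV[R]_n, the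
   components of a tangent vector in a chart are a column vector 'cV[R]_n, and
   an endomorphism of a tangent space is the matrix acting on columns, so that
   composition is *m. *)

Section Calculus.
Variables (R : realType) (n : nat).

Definition partial (i : 'I_n) (f : 'rV[R]_n -> R) : 'rV[R]_n -> R :=
  fun x => 'D_(delta_mx (0 : 'I_1) i) f x.

(* f is of class C^k on D, for D open; the values of f off D are irrelevant. *)
Fixpoint class_C (k : nat) (D : set 'rV[R]_n) (f : 'rV[R]_n -> R) : Prop :=
  (forall x, D x -> {for x, continuous f}) /\
  (if k is k'.+1 then
     forall i : 'I_n,
       (forall x, D x -> derivable f x (delta_mx (0 : 'I_1) i)) /\
       class_C k' D (partial i f)
   else True).

Definition smooth (D : set 'rV[R]_n) (f : 'rV[R]_n -> R) : Prop :=
  forall k, class_C k D f.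

End Calculus.

(* The values of chart_coord off chart_dom, and of chart_param off
   chart_coord @` chart_dom, are junk. *)
Record chart (R : realType) (n : nat) (T : topologicalType) := Chart {
  chart_dom : set T;
  chart_coord : T -> 'rV[R]_n;
  chart_param : 'rV[R]_n -> T;
  dom_open : open chart_dom;
  image_open : open (chart_coord @` chart_dom);
  coordK : forall p, chart_dom p -> chart_param (chart_coord p) = p;
  coord_continuous : forall p, chart_dom p -> {for p, continuous chart_coord};
  param_continuous : forall x, (chart_coord @` chart_dom) x ->
    {for x, continuous chart_param} }.

Definition transition (R : realType) (n : nat) (T : topologicalType)
  (c c' : chart R n T) : 'rV[R]_n -> 'rV[R]_n :=
  chart_coord c' \o chart_param c.

Record manifold (R : realType) (n : nat) := Manifold {
  carrier :> topologicalType;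
  carrier_hausdorff : hausdorff_space carrier;
  carrier_second_countable : @second_countable carrier;
  atlas : set (chart R n carrier);
  atlas_cover : forall p, exists2 c, atlas c & chart_dom c p;
  atlas_smooth : forall c c', atlas c -> atlas c' -> forall j : 'I_n,
    smooth (chart_coord c @` (chart_dom c `&` chart_dom c'))
      (fun x => transition c c' x 0 j) }.

(* [gram c p] is the Gram matrix (g_ij) at p of the coordinate frame of c.
   The library's 'J is the transpose of the usual Jacobian matrix. *)
Record riemannian_metric (R : realType) (n : nat) (M : manifold R n) :=
  RiemannianMetric {
  gram : chart R n M -> M -> 'M[R]_n;
  gram_sym : forall c p, atlas c -> chart_dom c p -> (gram c p)^T = gram c p;
  gram_pos : forall c p (v : 'cV[R]_n), atlas c -> chart_dom c p -> v != 0 ->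
    0 < (v^T *m gram c p *m v) 0 0;
  gram_smooth : forall c (i j : 'I_n), atlas c ->
    smooth (chart_coord c @` chart_dom c)
      (fun x => gram c (chart_param c x) i j);
  gram_change : forall c c' p, atlas c -> atlas c' ->
    chart_dom c p -> chart_dom c' p ->
    gram c p = 'J (transition c c') (chart_coord c p) *m gram c' p
               *m ('J (transition c c') (chart_coord c p))^T }.

Definition class_C_on (R : realType) (n : nat) (M : manifold R n)
    (k : nat) (Om : set M) (u : M -> R) : Prop :=
  forall c, atlas c ->
    class_C k (chart_coord c @` (chart_dom c `&` Om)) (u \o chart_param c).

(* Coordinate expressions; h is the metric (g_ij) in the chart. *)
Section LeviCivita.
Variables (R : realType) (n : nat) (h : 'rV[R]_n -> 'M[R]_n).
Implicit Types (x : 'rV[R]_n) (U V X Y Z : 'rV[R]_n -> 'cV[R]_n).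

(* Gamma^k_ij *)
Definition christoffel x (k i j : 'I_n) : R :=
  2^-1 * \sum_l invmx (h x) k l *
    (partial i (fun y => h y j l) x + partial j (fun y => h y i l) x
     - partial l (fun y => h y i j) x).

(* The endomorphism v |-> nabla_v V. *)
Definition nabla V x : 'M[R]_n :=
  \matrix_(k, j) (partial j (fun y => V y k 0) x
                  + \sum_i christoffel x k j i * V x i 0).

Definition cov U V : 'rV[R]_n -> 'cV[R]_n := fun x => nabla V x *m U x.

Definition div_g V x : R := \tr (nabla V x).

Definition lie_bracket X Y : 'rV[R]_n -> 'cV[R]_n := fun x =>
  \col_k \sum_j (X x j 0 * partial j (fun y => Y y k 0) x
                 - Y x j 0 * partial j (fun y => X y k 0) x).

Definition curvature_field X Y Z : 'rV[R]_n -> 'cV[R]_n := fun x =>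
  cov Y (cov X Z) x - cov X (cov Y Z) x + cov (lie_bracket X Y) Z x.

(* The curvature is tensorial: tangent vectors at x are extended to fields with
   constant components. *)
Definition riemann_curvature x (v w z : 'cV[R]_n) : 'cV[R]_n :=
  curvature_field (cst v) (cst w) (cst z) x.

Definition grad_g (f : 'rV[R]_n -> R) : 'rV[R]_n -> 'cV[R]_n := fun x =>
  invmx (h x) *m \col_i partial i f x.

Definition norm_g x (v : 'cV[R]_n) : R := Num.sqrt ((v^T *m h x *m v) 0 0).

End LeviCivita.

Section SymmetricFunctions.
Variables (R : realType) (n : nat).
Implicit Types (B : 'M[R]_n) (r : nat).

Definition elementary_symmetric r (k : 'rV[R]_n) : R :=
  \sum_(I : {set 'I_n} | #|I| == r) \prod_(i in I) k 0 i.

(* The eigenvalues with multiplicity, in an arbitrary order; the default value 0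
   is only taken if the characteristic polynomial does not split over R, which
   does not happen for a shape operator. *)
Definition eigenvalues B : 'rV[R]_n :=
  xget 0 [set k : 'rV[R]_n | char_poly B = \prod_i ('X - (k 0 i)%:P)].

Definition S_ r B : R := elementary_symmetric r (eigenvalues B).

Definition H_ r B : R := S_ r B / 'C(n, r)%:R.

Fixpoint newton r B : 'M[R]_n :=
  if r is r'.+1 then (S_ r B)%:M - B *m newton r' B else 1%:M.

End SymmetricFunctions.

Section Graph.
Variables (R : realType) (n : nat).
Variables (h : 'rV[R]_n -> 'M[R]_n) (u : 'rV[R]_n -> R).
Implicit Types (x : 'rV[R]_n) (v w : 'cV[R]_n).

(* W = sqrt (1 + |grad u|^2) *)
Definition slant x : R := Num.sqrt (1 + norm_g h x (grad_g h u x) ^+ 2).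

Definition grad_over_W : 'rV[R]_n -> 'cV[R]_n := fun x =>
  (slant x)^-1 *: grad_g h u x.

Definition shape_operator x : 'M[R]_n := nabla h grad_over_W x.

(* For u of class C^2 and r >= 1 this field is in general only continuous: its
   divergence makes sense at the points where it is differentiable. *)
Definition newton_grad r : 'rV[R]_n -> 'cV[R]_n := fun x =>
  newton r (shape_operator x) *m grad_over_W x.

Definition map_trace (F : 'cV[R]_n -> 'cV[R]_n) : R :=
  \tr (\matrix_(i, j) F (delta_mx j 0) i 0).

Definition tau_ s x v w : R :=
  map_trace (fun z => newton s.-1 (shape_operator x)
                       *m riemann_curvature h x v z w).

(* Only s >= 1 is meaningful; the value 0 at s = 0 makes J_1 = tau_1. *)
Fixpoint J_ s x v w : R :=
  if s is s'.+1 then tau_ s x v w - J_ s' x (shape_operator x *m v) w else 0.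

End Graph.

(* Main.v *)
(* Put X = grad u / W and A = nabla X.  For every vector field X of class C^2,
   the Ricci identity (nabla_j A) e_k - (nabla_k A) e_j = R(e_k, e_j) X together with
   dS_(r+1) = tr (P_r dA) and the recursion defining P_r gives, by induction on r,
   (div P_r)(v) = - J_r(v, X); since tr (P_r A) = (r+1) S_(r+1), this is the formula.
   Here S_r and P_r are polynomials in the entries of A (Faddeev-LeVerrier
   recursion); they agree with the eigenvalue definition because A is
   self-adjoint for the induced metric g + du^2, so that its characteristic
   polynomial splits.

   As u is only C^2, X is only C^1 and P_r X is merely continuous, so X is
   approximated in C^1 by C^2 fields.  The right-hand side converges uniformly,
   hence is the distributional divergence of P_r X, and at a point where a
   continuous field is differentiable its classical divergence is equal to its
   continuous distributional divergence, by comparing fluxes through small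
   cubes. *)
Require Import Defs.
From HB Require Import structures.
From mathcomp Require Import all_boot all_order all_algebra.
From mathcomp Require Import complex.
From mathcomp Require Import all_classical all_reals all_analysis.
From mathcomp Require Import zify ring lra.
Import Order.TTheory GRing.Theory Num.Theory.
Import numFieldNormedType.Exports.
Local Open Scope classical_set_scope.
Local Open Scope ring_scope.
Set Implicit Arguments.
Unset Strict Implicit.
Unset Printing Implicit Defensive.


(** * Elementary symmetric functions and Newton tensors *)

(** The approximants of X are arbitrary C^2 fields, not normalised gradients, so their covariant
    derivatives need not have real eigenvalues. Hence the differential identity is proved for
    [sigma] and [newton_poly] of an arbitrary matrix, and dS_(r+1) = tr (P_r dA) is derived
    algebraically from Newton's identities, without diagonalisation. It is X that is regularised and
    not P_r X: closeness in C^1 passes through the polynomials to A, P_r and J_r, whereas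
    differentiability of P_r X at one point gives no control nearby. Both analytic ingredients rest
    on the mean over a segment in a coordinate direction. Such a mean gains a derivative in its own
    direction, which gives the C^2 approximation. Iterated over all directions it is a mean over a
    small cube, and there the mean of a partial derivative is a difference quotient, that is, the
    flux through two opposite faces. Self-adjointness for g + du^2 comes from (g + du^2)(nabla_j X,
    .) = W^-1 Hess u (e_j, .): differentiating W^-2 (1 + |grad u|^2) = 1 shows that the terms along
    du cancel. *)

Section ElementarySymmetric.
Variables (F : comNzRingType) (n : nat).
Implicit Types (d : 'I_n -> F).

Definition elemsym r d : F := \sum_(I : {set 'I_n} | #|I| == r) \prod_(i in I) d i.

(** These turn out to be the diagonal entries of the r-th Newton tensor of a triangular matrix with
    diagonal [d]. *)
Definition elemsym_without i r d : F :=
  \sum_(I : {set 'I_n} | (#|I| == r) && (i \notin I)) \prod_(j in I) d j.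

Lemma sum_containing i r d :
  \sum_(I : {set 'I_n} | (#|I| == r.+1) && (i \in I)) \prod_(j in I) d j
  = d i * elemsym_without i r d.
Proof.
rewrite /elemsym_without big_distrr /=.
rewrite (reindex_onto (fun I : {set 'I_n} => i |: I) (fun I => I :\ i)) /=; last first.
  by move=> I /andP[_ iI]; rewrite finset.setD1K.
apply: eq_big => [I|I /andP[/andP[/eqP cI _] /eqP DI]].
  rewrite finset.setU11 andbT; case: (boolP (i \in I)) => iI /=.
    rewrite andbF; apply/negP => /andP[_ /eqP E].
    by move: iI; rewrite -E finset.setD11.
  by rewrite finset.cardsU1 iI /= add1n eqSS finset.setU1K// eqxx !andbT.
have iI : i \notin I by rewrite -DI finset.setD11.
by rewrite big_setU1.
Qed.

Lemma elemsymS i r d :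
  elemsym r.+1 d = elemsym_without i r.+1 d + d i * elemsym_without i r d.
Proof.
rewrite -sum_containing /elemsym /elemsym_without (bigID (fun I : {set 'I_n} => i \in I)) /=.
by rewrite addrC.
Qed.

Lemma elemsym0 d : elemsym 0 d = 1.
Proof.
rewrite /elemsym (big_pred1 finset.set0) ?finset.big_set0// => I.
by rewrite cards_eq0.
Qed.

Lemma elemsym_without0 i d : elemsym_without i 0 d = 1.
Proof.
rewrite /elemsym_without (big_pred1 finset.set0) ?finset.big_set0// => I.
by rewrite cards_eq0 /=; case: (altP (I =P finset.set0)) => //= ->; rewrite inE.
Qed.

(** Double counting: each set of [r.+1] indices is met once for each of its elements. *)
Lemma sum_elemsym_without r d :
  \sum_i d i * elemsym_without i r d = r.+1%:R * elemsym r.+1 d.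
Proof.
under eq_bigr do rewrite -sum_containing big_mkcondr.
rewrite exchange_big /= /elemsym big_distrr /=; apply: eq_bigr => I /eqP cI.
by rewrite -big_mkcond /= sumr_const cI mulr_natl.
Qed.

(** Vieta's formula. When the product is expanded, a subset records the factors that contribute
    ['X]; its complement is the set that occurs in [elemsym]. *)
Lemma elemsym_coef r d : (r <= n)%N ->
  elemsym r d = (-1) ^+ r * (\prod_i ('X - (d i)%:P))`_(n - r).
Proof.
move=> rn; rewrite (bigA_distr (1 : {poly F}) _ (fun=> 'X)) coef_sum /elemsym.
have EJ (J : {set 'I_n}) : \prod_i (if i \in J then 'X else - (d i)%:P) =
    'X^#|J| * ((-1) ^+ #|~: J| * \prod_(i in ~: J) d i)%:P :> {poly F}.
  rewrite -prodrN (bigID (mem J)) /= rmorph_prod; congr (_ * _).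
    by rewrite -prodr_const; apply: eq_bigr => i /= ->.
  apply: eq_big => i; first by rewrite inE.
  by move=> /negbTE -> /=; rewrite polyCN.
under [in RHS]eq_bigr do rewrite EJ coefXnM coefC.
rewrite (reindex_inj (inv_inj (@finset.setCK _))) /=.
rewrite big_distrr /= [RHS](bigID (fun J : {set 'I_n} => #|~: J| == r)) /=.
rewrite [X in _ + X]big1 ?addr0 => [|J /eqP cJ].
  apply: eq_bigr => J /eqP cJ.
  have cJ' : #|J| = (n - r)%N by have := cardsC J; rewrite cJ card_ord; lia.
  rewrite cJ' ltnn subnn eqxx cJ.
  by rewrite mulrA -exprD addnn -signr_odd odd_double expr0 mul1r.
case: ltngtP => [|lt|E]; rewrite ?mulr0//.
  by rewrite subn_eq0 leqNgt lt mulr0.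
by case: cJ; rewrite -[LHS](addKn #|J|) cardsC card_ord -E subKn.
Qed.

End ElementarySymmetric.

(** * The Faddeev-LeVerrier recursion *)

Section FaddeevLeVerrier.
Variables (F : fieldType) (n : nat).
Implicit Types (B : 'M[F]_n).

(** The division by the index comes from tr (B P_(r-1)) = r S_r. No eigenvalue enters, so the
    recursion can be run over any field, is compatible with conjugation and field morphisms, and can
    be differentiated entry by entry. *)
Fixpoint faddeev B r : F * 'M[F]_n :=
  if r is r'.+1 then
    let BN := B *m (faddeev B r').2 in
    let s := \tr BN / r%:R in (s, s%:M - BN)
  else (1, 1%:M).

Definition sigma r B := (faddeev B r).1.
Definition newton_poly r B := (faddeev B r).2.

Lemma sigmaS r B : sigma r.+1 B = \tr (B *m newton_poly r B) / r.+1%:R.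
Proof. by []. Qed.

Lemma newton_polyS r B :
  newton_poly r.+1 B = (sigma r.+1 B)%:M - B *m newton_poly r B.
Proof. by []. Qed.

Lemma newton_poly_comm r B : B *m newton_poly r B = newton_poly r B *m B.
Proof.
elim: r => [|r IH]; first by rewrite mulmx1 mul1mx.
by rewrite newton_polyS mulmxBr mulmxBl scalar_mxC {1}IH !mulmxA.
Qed.

Lemma faddeev_conj Q B r : Q \in unitmx ->
  sigma r (invmx Q *m B *m Q) = sigma r B /\
  newton_poly r (invmx Q *m B *m Q) = invmx Q *m newton_poly r B *m Q.
Proof.
move=> Qu; elim: r => [|r [_ IH2]].
  by split => //; rewrite /newton_poly /= mulmx1 mulVmx.
have E : invmx Q *m B *m Q *m newton_poly r (invmx Q *m B *m Q) =
         invmx Q *m (B *m newton_poly r B) *m Q.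
  by rewrite IH2 !mulmxA mulmxK.
have S : sigma r.+1 (invmx Q *m B *m Q) = sigma r.+1 B.
  by rewrite !sigmaS E mxtrace_mulC mulmxA mulmxV// mul1mx.
split=> //; rewrite !newton_polyS E S mulmxBr mulmxBl; congr (_ - _).
by rewrite scalar_mxC -mulmxA mulVmx// mulmx1.
Qed.

End FaddeevLeVerrier.

Lemma map_faddeev (F K : fieldType) (f : {rmorphism F -> K}) n (B : 'M[F]_n) r :
  sigma r (map_mx f B) = f (sigma r B) /\
  newton_poly r (map_mx f B) = map_mx f (newton_poly r B).
Proof.
elim: r => [|r [_ IH]]; first by rewrite /sigma /newton_poly /= rmorph1 map_mx1.
have E : sigma r.+1 (map_mx f B) = f (sigma r.+1 B).
  by rewrite !sigmaS IH -map_mxM trace_map_mx fmorph_div /= rmorph_nat.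
split => //; rewrite !newton_polyS E IH map_mxB map_scalar_mx map_mxM.
by [].
Qed.

Lemma trig_mulmx (F : pzSemiRingType) n (A B : 'M[F]_n) :
  is_trig_mx A -> is_trig_mx B ->
  is_trig_mx (A *m B) /\ forall i, (A *m B) i i = A i i * B i i.
Proof.
move=> /is_trig_mxP tA /is_trig_mxP tB; split=> [|i].
  apply/is_trig_mxP => i j ij; rewrite mxE big1// => k _.
  have [ik|ki] := ltnP i k; first by rewrite tA// mul0r.
  by rewrite tB ?mulr0//; apply: leq_ltn_trans ij.
rewrite mxE (bigD1 i) //= big1 ?addr0// => k ki.
have [ik|ki'] := ltnP i k; first by rewrite tA// mul0r.
by rewrite tB ?mulr0// ltn_neqAle; apply/andP; split.
Qed.

(** Products of triangular matrices multiply the diagonals, so on the diagonal the recursion runs as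
    if [T] were diagonal; there it reduces to [sum_elemsym_without] and [elemsymS]. *)
Lemma faddeev_trig (F : numFieldType) n (T : 'M[F]_n) r : is_trig_mx T ->
  [/\ sigma r T = elemsym r (fun i => T i i), is_trig_mx (newton_poly r T) &
      forall i, newton_poly r T i i = elemsym_without i r (fun i => T i i)].
Proof.
move=> tT; elim: r => [|r [_ tN dN]].
  rewrite /sigma /newton_poly /= elemsym0; split => [//||i].
    exact: scalar_mx_is_trig.
  by rewrite mxE eqxx elemsym_without0.
have [tTN dTN] := trig_mulmx tT tN.
have E : sigma r.+1 T = elemsym r.+1 (fun i => T i i).
  rewrite sigmaS /mxtrace; under eq_bigr do rewrite dTN dN.
  by rewrite sum_elemsym_without mulrAC mulfV ?pnatr_eq0// mul1r.
split=> [//||i]; rewrite newton_polyS.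
  apply/is_trig_mxP => i j ij; rewrite !mxE.
  have /is_trig_mxP/(_ i j ij) := tTN; rewrite !mxE => ->.
  by rewrite subr0 -val_eqE ltn_eqF// mulr0n.
rewrite 2!mxE eqxx mulr1n [X in _ + X]mxE dTN dN E (elemsymS i).
by rewrite addrK.
Qed.


Lemma char_poly_conj (F : fieldType) n (Q B : 'M[F]_n) : Q \in unitmx ->
  char_poly (invmx Q *m B *m Q) = char_poly B.
Proof.
move=> Qu; rewrite /char_poly.
have -> : char_poly_mx (invmx Q *m B *m Q) =
    map_mx polyC (invmx Q) *m char_poly_mx B *m map_mx polyC Q.
  rewrite /char_poly_mx mulmxBr mulmxBl !map_mxM; congr (_ - _).
  by rewrite scalar_mxC -mulmxA -map_mxM mulVmx// map_mx1 mulmx1.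
rewrite !det_mulmx mulrAC -det_mulmx -map_mxM mulVmx// map_mx1 det1 mul1r.
by [].
Qed.

(** * Matrices with real spectrum *)

Section RealMatrices.
Variables (R : rcfType) (n : nat).
Implicit Types (B : 'M[R]_n).

(** Over the complex numbers [B] is conjugate to a triangular matrix by Schur's theorem, and [sigma]
    is invariant under conjugation and under the extension of scalars. *)
Lemma sigma_split B (k : 'I_n -> R) r : (0 < n)%N -> (r <= n)%N ->
  char_poly B = \prod_i ('X - (k i)%:P) -> sigma r B = elemsym r k.
Proof.
move=> n0 rn HB; pose f : {rmorphism R -> complex R} := real_complex R.
have [P Pu] := Schur (map_mx f B) n0.
have {Pu}Puu := unitarymx_unit Pu.
rewrite [similar_trig _ _]/(is_trig_mx _) (conjumx _ Puu) => tT.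
set T := P *m _ *m _ in tT.
have ET : T = invmx (invmx P) *m map_mx f B *m invmx P by rewrite invmxK.
have [Es _ _] := faddeev_trig r tT.
have Pv : invmx P \in unitmx by rewrite unitmx_inv.
move: Es; rewrite {1}ET (faddeev_conj _ _ Pv).1 (map_faddeev _ _ _).1.
(* Comparing coefficients of the characteristic polynomial avoids matching the diagonal of [T] with
   the values of [k] up to a permutation. *)
rewrite [RHS]elemsym_coef// -char_poly_trig// ET char_poly_conj// -map_char_poly HB.
rewrite coef_map /= -[(-1) ^+ r](rmorph_sign f) -rmorphM /= -elemsym_coef//.
exact: (fmorph_inj f).
Qed.

(** The characteristic polynomial splits over the complex numbers; positivity of [G] forces the
    imaginary part of each root to vanish, so no orthonormal eigenbasis has to be built. *)
Lemma selfadjoint_split (G A : 'M[R]_n) :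
  G^T = G -> (forall v : 'rV_n, v != 0 -> 0 < (v *m G *m v^T) 0 0) ->
  (G *m A)^T = G *m A ->
  exists d : 'I_n -> R, char_poly A = \prod_i ('X - (d i)%:P).
Proof.
move=> Gs Gp GA; pose f : {rmorphism R -> complex R} := real_complex R.
have [s Es] := closed_field_poly_normal (char_poly (map_mx f A)).
rewrite (monicP (char_poly_monic _)) scale1r in Es.
have sz : size s = n.
  by have := size_char_poly (map_mx f A); rewrite Es size_prod_XsubC => -[].
have sr z : z \in s -> complex.Im z = 0.
  rewrite -root_prod_XsubC -Es -map_char_poly => rz.
  (* Library eigenvectors are rows while [A] acts on columns, hence the transpose. *)
  have : root (char_poly (map_mx f A^T)) z.
    rewrite -map_char_poly; suff -> : char_poly A^T = char_poly A by [].
    rewrite /char_poly -[RHS]det_tr; congr (\det _).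
    by rewrite /char_poly_mx linearB /= tr_scalar_mx map_trmx.
  rewrite -eigenvalue_root_char => /eigenvalueP[v Ev v0].
  pose a : 'rV[R]_n := map_mx (@complex.Re R) v; pose b : 'rV[R]_n := map_mx (@complex.Im R) v.
  have [p [q E]] : exists p q, z = (p +i* q)%C.
    by case: z {rz Ev} => p q; exists p, q.
  have Ea : a *m A^T = p *: a - q *: b.
    apply/rowP => j; have /rowP/(_ j)/(congr1 (@complex.Re R)) := Ev.
    rewrite !mxE E (raddf_sum (@complex.Re R)) /=; case: (v 0 j) => x y /= <-.
    by apply: eq_bigr => i _; rewrite !mxE; case: (v 0 i) => ? ? /=; ring.
  have Eb : b *m A^T = p *: b + q *: a.
    apply/rowP => j; have /rowP/(_ j)/(congr1 (@complex.Im R)) := Ev.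
    rewrite !mxE E (raddf_sum (@complex.Im R)) /=; case: (v 0 j) => x y /= <-.
    by apply: eq_bigr => i _; rewrite !mxE; case: (v 0 i) => ? ? /=; ring.
  have sc (M : 'M[R]_1) : M^T 0 0 = M 0 0 by rewrite mxE.
  have Eab : (a *m G *m b^T) 0 0 = (b *m G *m a^T) 0 0.
    by rewrite -sc !trmx_mul trmxK Gs mulmxA.
  (* With z = p + iq and v = a + ib, this symmetry reduces to q (a G a^T + b G b^T) = 0. If q were
     nonzero, both squares would vanish, contradicting v != 0. *)
  have : (a *m A^T *m G *m b^T) 0 0 = (b *m A^T *m G *m a^T) 0 0.
    have AG : A^T *m G = G *m A by rewrite -GA trmx_mul Gs.
    by rewrite -(mulmxA a) -(mulmxA b) AG -sc 2!trmx_mul GA trmxK mulmxA.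
  rewrite Ea Eb !(mulmxBl, mulmxDl) -!scalemxAl.
  have dD (M N : 'M[R]_1) : (M + N) 0 0 = M 0 0 + N 0 0 by rewrite mxE.
  have dN (M : 'M[R]_1) : (- M) 0 0 = - M 0 0 by rewrite mxE.
  have dZ t (M : 'M[R]_1) : (t *: M) 0 0 = t * M 0 0 by rewrite mxE.
  rewrite !(dD, dN, dZ) Eab => /addrI/eqP.
  rewrite -subr_eq0 -opprD -mulrDr oppr_eq0 mulf_eq0 => /orP[/eqP q0|].
    by rewrite E.
  have Gn (w : 'rV_n) : 0 <= (w *m G *m w^T) 0 0.
    by have [->|/Gp/ltW//] := eqVneq w 0; rewrite !mul0mx mxE.
  rewrite paddr_eq0// => /andP[b0 a0].
  have wE (w : 'rV_n) : (w *m G *m w^T) 0 0 == 0 -> w = 0.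
    by move=> w0; apply/eqP; apply: contraTT w0 => /Gp/gt_eqF ->.
  move: v0; have -> : v = 0; last by rewrite eqxx.
  apply/rowP => j; have /rowP/(_ j) := wE _ a0; have /rowP/(_ j) := wE _ b0.
  by rewrite !mxE; case: (v 0 j) => x y /= -> ->.
exists (fun i : 'I_n => complex.Re s`_i).
apply: (map_poly_inj f); rewrite map_char_poly Es (big_nth 0) sz big_mkord.
rewrite rmorph_prod; apply: eq_bigr => i _.
rewrite rmorphB /= map_polyX map_polyC /=; congr (_ - _%:P).
have /sr : s`_i \in s by rewrite mem_nth// sz.
by case: s`_i => x y /= ->.
Qed.

End RealMatrices.

(** * The differential of the Newton tensors *)

Section FaddeevDifferential.
Variables (F : numFieldType) (n : nat).
Implicit Types (B dB C : 'M[F]_n).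

(** The product rule applied formally to [faddeev]. Since [dB] is any matrix, it may also be the
    covariant derivative of a field of endomorphisms. *)
Fixpoint dfaddeev B dB r : F * 'M[F]_n :=
  if r is r'.+1 then
    let dBN := dB *m newton_poly r' B + B *m (dfaddeev B dB r').2 in
    let ds := \tr dBN / r%:R in (ds, ds%:M - dBN)
  else (0, 0).

Definition dsigma r B dB := (dfaddeev B dB r).1.
Definition dnewton r B dB := (dfaddeev B dB r).2.

Lemma dsigmaS r B dB :
  dsigma r.+1 B dB = \tr (dB *m newton_poly r B + B *m dnewton r B dB) / r.+1%:R.
Proof. by []. Qed.

Lemma dnewtonS r B dB : dnewton r.+1 B dB =
  (dsigma r.+1 B dB)%:M - (dB *m newton_poly r B + B *m dnewton r B dB).
Proof. by []. Qed.

Lemma dfaddeevD B dB dC r :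
  dsigma r B (dB + dC) = dsigma r B dB + dsigma r B dC /\
  dnewton r B (dB + dC) = dnewton r B dB + dnewton r B dC.
Proof.
elim: r => [|r [_ IH]]; first by rewrite /dsigma /dnewton /= !addr0.
have E : dsigma r.+1 B (dB + dC) = dsigma r.+1 B dB + dsigma r.+1 B dC.
  by rewrite !dsigmaS IH mulmxDl mulmxDr addrACA raddfD mulrDl.
split=> //; rewrite !dnewtonS E IH raddfD /= mulmxDl mulmxDr.
by rewrite addrACA opprD addrACA.
Qed.

(** Infinitesimal form of [faddeev_conj]. The Christoffel terms in the covariant derivative of an
    endomorphism are such a commutator, so this turns partial derivatives of [sigma] and
    [newton_poly] into covariant ones. *)
Lemma dfaddeev_comm B C r :
  dsigma r B (C *m B - B *m C) = 0 /\
  dnewton r B (C *m B - B *m C) = C *m newton_poly r B - newton_poly r B *m C.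
Proof.
elim: r => [|r [_ IH]].
  by rewrite /dsigma /dnewton /newton_poly /= mul1mx mulmx1 subrr.
have E : (C *m B - B *m C) *m newton_poly r B +
    B *m dnewton r B (C *m B - B *m C) =
    C *m (B *m newton_poly r B) - (B *m newton_poly r B) *m C.
  by rewrite IH mulmxBl mulmxBr -!mulmxA addrA subrK.
have S : dsigma r.+1 B (C *m B - B *m C) = 0.
  by rewrite dsigmaS E raddfB /= mxtrace_mulC subrr mul0r.
split=> //; rewrite dnewtonS E S raddf0 sub0r newton_polyS.
rewrite mulmxBr mulmxBl -scalar_mxC !opprB.
by rewrite [RHS]addrC addrA subrK.
Qed.

Lemma newton_poly_sum r B :
  newton_poly r B = \sum_(j < r.+1) (-1) ^+ j *: (sigma (r - j) B *: B ^+ j).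
Proof.
elim: r => [|r IH].
  by rewrite big_ord1 expr0 !scale1r.
rewrite newton_polyS big_ord_recl /= expr0 subn0 scale1r -scalemx1; congr (_ + _).
rewrite IH mulmx_sumr -sumrN; apply: eq_bigr => j _.
by rewrite /bump /= add1n subSS exprS mulN1r scaleNr -!scalemxAr exprS.
Qed.

(** Newton's identities between elementary symmetric functions and power sums, read off from the
    trace of the unrolled recursion. *)
Lemma newton_identity r B :
  \sum_(j < r.+1) (-1) ^+ j * (sigma (r - j) B * \tr (B ^+ j.+1))
  = r.+1%:R * sigma r.+1 B.
Proof.
rewrite sigmaS mulrC divfK ?pnatr_eq0// newton_poly_sum mulmx_sumr raddf_sum.
apply: eq_bigr => j _ /=.
by rewrite -!scalemxAr !mxtraceZ exprS.
Qed.

(** For a diagonal [B], entry i is Newton's identity for the eigenvalues other than the i-th: tr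
    B^(j+1) - B^(j+1) has their power sums on its diagonal, and the Newton tensors have their
    elementary symmetric functions. *)
Lemma newton_poly_derivation_sum r B :
  \sum_(j < r) (-1) ^+ j *:
     (((\tr (B ^+ j.+1))%:M - B ^+ j.+1) *m newton_poly (r - j.+1) B)
  = r%:R *: newton_poly r B.
Proof.
elim: r => [|r IH]; first by rewrite big_ord0 scale0r.
(* For j < r the recursion is substituted for the Newton tensor; the last term needs no
   substitution, because [newton_poly 0] and [(sigma 0)%:M] are both the identity. *)
have E : \sum_(j < r.+1) (-1) ^+ j *:
     (((\tr (B ^+ j.+1))%:M - B ^+ j.+1) *m newton_poly (r.+1 - j.+1) B) =
  \sum_(j < r.+1) (-1) ^+ j *:
     (((\tr (B ^+ j.+1))%:M - B ^+ j.+1) *m (sigma (r - j) B)%:M) -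
  \sum_(j < r) (-1) ^+ j *:
     (((\tr (B ^+ j.+1))%:M - B ^+ j.+1) *m (B *m newton_poly (r - j.+1) B)).
  rewrite big_ord_recr [in RHS]big_ord_recr /= !subnn addrAC -sumrB; congr (_ + _).
  apply: eq_bigr => j _; rewrite subSS -scalerBr -mulmxBr.
  by rewrite -(subnSK (ltn_ord j)) -newton_polyS.
rewrite E; set s1 := (X in X - _); set s2 := (X in _ - X).
have -> : s2 = B *m (r%:R *: newton_poly r B).
  rewrite -IH mulmx_sumr; apply: eq_bigr => j _.
  rewrite -scalemxAr !mulmxA; congr (_ *: (_ *m _)).
  by rewrite mulmxBl mulmxBr scalar_mxC; congr (_ - _); rewrite !mulmxE -exprS -exprSr.
have -> : s1 = (r.+1%:R * sigma r.+1 B)%:M - B *m newton_poly r B.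
  rewrite -newton_identity newton_poly_sum mulmx_sumr raddf_sum -sumrB.
  apply: eq_bigr => j _ /=.
  rewrite mulmxBl scalerBr -scalar_mxM scale_scalar_mx [\tr _ * _]mulrC.
  by rewrite mul_mx_scalar -!scalemxAr exprS.
rewrite -scalemxAr newton_polyS scalerBr scale_scalar_mx.
by rewrite -addrA -opprD -[X in _ - (X + _)]scale1r -scalerDl nat1r.
Qed.

(** Each unfolding of [dnewton] produces one more factor [B] on the left, which the free exponent
    [m] absorbs. The hypothesis is the formula of [dsigma_trace] in lower rank, available in the
    strong induction there. *)
Lemma trace_dnewton B dB r m :
  (forall k, (k < r)%N -> dsigma k.+1 B dB = \tr (newton_poly k B *m dB)) ->
  \tr (B ^+ m *m dnewton r B dB) =
  \tr ((\sum_(j < r) (-1) ^+ j *: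
     (((\tr (B ^+ (m + j)))%:M - B ^+ (m + j)) *m newton_poly (r - j.+1) B)) *m dB).
Proof.
elim: r m => [|r IH] m H.
  by rewrite big_ord0 mul0mx mulmx0.
rewrite dnewtonS mulmxBr mulmxDr !raddfB /= raddfD /= big_ord_recl /=.
rewrite expr0 scale1r addn0 subSS subn0 [X in _ = \tr X]mulmxDl [RHS]mxtraceD.
have -> : B ^+ m *m (B *m dnewton r B dB) = B ^+ m.+1 *m dnewton r B dB.
  by rewrite mulmxA exprSr.
rewrite IH => [|k kr]; last by rewrite H// ltnW.
rewrite opprD addrA; congr (_ + _).
  rewrite H// mul_mx_scalar mxtraceZ mulmxBl mulmxBl raddfB /=.
  rewrite -mulmxA mul_scalar_mx mxtraceZ mulrC; congr (_ - _).
  rewrite mulmxA mxtrace_mulC mulmxA; congr (\tr (_ *m _)).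
  have NB : GRing.comm (newton_poly r B) B by rewrite /GRing.comm -mulmxE newton_poly_comm.
  exact: (commrX m NB).
rewrite !(mxtrace_mulC _ dB) -raddfN -mulmxN; congr (\tr (_ *m _)).
rewrite -sumrN; apply: eq_bigr => j _.
by rewrite /bump /= add1n exprS mulN1r scaleNr addSnnS subSS.
Qed.

(** In (r+1) dS_(r+1) = tr (dB P_r) + tr (B dP_r) the second trace is r tr (P_r dB), by
    [trace_dnewton] at m = 1 and [newton_poly_derivation_sum]. *)
Lemma dsigma_trace r B dB : dsigma r.+1 B dB = \tr (newton_poly r B *m dB).
Proof.
elim/ltn_ind: r => r IH; rewrite dsigmaS mxtraceD.
have := trace_dnewton 1 IH; rewrite expr1 => ->.
under eq_bigr do rewrite add1n.
rewrite newton_poly_derivation_sum -scalemxAl mxtraceZ mxtrace_mulC.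
by rewrite -[X in X + _]mul1r -mulrDl nat1r mulrC mulKf// pnatr_eq0.
Qed.

End FaddeevDifferential.

(** * Functions of class C^k *)

Notation e_ i := (delta_mx (0 : 'I_1) i).

Section ClassC.
Variables (R : realType) (n : nat).
Implicit Types (f g : 'rV[R]_n -> R) (D E : set 'rV[R]_n).

Definition class_C0 D f := forall x, D x -> {for x, continuous f}.

Lemma class_C1E D f : class_C 1 D f <->
  class_C0 D f /\ (forall i, (forall x, D x -> derivable f x (e_ i)) /\
                             class_C0 D (partial i f)).
Proof.
split=> [[cf df]|[cf df]]; split=> // i; have [d c] := df i; split=> //.
by case: c.
Qed.

Lemma class_C_subset k D E f : E `<=` D -> class_C k D f -> class_C k E f.
Proof.
move=> ED; elim: k f => [|k IH] f [cf df].
  by split=> // x /ED/cf.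
split=> [x /ED/cf//|i].
by have [d c] := df i; split=> [x /ED/d//|]; apply: IH.
Qed.

Lemma class_CS k D f : class_C k.+1 D f -> class_C k D f.
Proof.
elim: k f => [|k IH] f [cf df]; split=> // i.
by have [d c] := df i; split=> //; apply: IH.
Qed.

Lemma open_near_eq D f g x : open D -> D x -> (forall y, D y -> f y = g y) ->
  {near x, f =1 g}.
Proof.
move=> Do Dx fg; near=> y; apply: fg; near: y.
exact: open_nbhs_nbhs.
Unshelve. all: by end_near. Qed.

Lemma class_C0_eq D f g : open D -> (forall x, D x -> f x = g x) ->
  class_C0 D f -> class_C0 D g.
Proof.
move=> Do fg cf x Dx; rewrite /prop_for /continuous_at -fg//.
apply: cvg_trans (cf x Dx); apply: (@near_eq_cvg _ _ (nbhs x)).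
exact: (open_near_eq Do Dx).
Qed.

Lemma class_C_eq k D f g : open D -> (forall x, D x -> f x = g x) ->
  class_C k D f -> class_C k D g.
Proof.
move=> Do; elim: k f g => [|k IH] f g fg [cf df]; split => //.
- exact: class_C0_eq cf.
- exact: class_C0_eq cf.
- move=> i; have [d c] := df i; split=> [x Dx|].
  + exact: near_eq_derivable (open_near_eq Do Dx fg) (d x Dx).
  + apply: IH c => x Dx; apply: near_eq_derive.
    exact: (open_near_eq Do Dx).
Qed.

Lemma partialD i f g x : derivable f x (e_ i) -> derivable g x (e_ i) ->
  partial i (fun y => f y + g y) x = partial i f x + partial i g x.
Proof. by move=> df dg; rewrite /partial (deriveD df dg). Qed.

Lemma partialN i f x : derivable f x (e_ i) ->
  partial i (fun y => - f y) x = - partial i f x.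
Proof. by move=> df; rewrite /partial (deriveN df). Qed.

Lemma partialM i f g x : derivable f x (e_ i) -> derivable g x (e_ i) ->
  partial i (fun y => f y * g y) x = partial i f x * g x + f x * partial i g x.
Proof.
move=> df dg; rewrite /partial (deriveM df dg) addrC; congr (_ + _).
by rewrite mulrC.
Qed.

Lemma partial_cst i (a : R) (x : 'rV[R]_n) : partial i (fun _ => a) x = 0.
Proof. exact: derive_cst. Qed.

Lemma partial_sum (I : Type) (r : seq I) (P : pred I) i (F : I -> 'rV[R]_n -> R) x :
  (forall j, derivable (F j) x (e_ i)) ->
  derivable (fun y => \sum_(j <- r | P j) F j y) x (e_ i) /\
  partial i (fun y => \sum_(j <- r | P j) F j y) x = \sum_(j <- r | P j) partial i (F j) x.
Proof.
move=> dF; elim: r => [|j r [IHd IHe]].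
  have E : (fun y => \sum_(j <- [::] | P j) F j y) = cst 0.
    by apply/funext => y; rewrite big_nil.
  by rewrite E big_nil; split; [exact: derivable_cst|exact: derive_cst].
have E : (fun y => \sum_(j <- j :: r | P j) F j y) =
  (fun y => (if P j then F j y else 0) + \sum_(j <- r | P j) F j y).
  by apply/funext => y; rewrite big_cons; case: ifP => //; rewrite add0r.
rewrite E big_cons; case: (P j).
  by split; [exact: (derivableD (dF j) IHd)|rewrite (partialD (dF j) IHd) IHe].
by under eq_fun do rewrite add0r.
Qed.

Lemma class_C0D D f g : class_C0 D f -> class_C0 D g -> class_C0 D (fun x => f x + g x).
Proof. by move=> cf cg x Dx; exact: (cvgD (cf x Dx) (cg x Dx)). Qed.

Lemma class_C0N D f : class_C0 D f -> class_C0 D (fun x => - f x).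
Proof. by move=> cf x Dx; exact: (cvgN (cf x Dx)). Qed.

Lemma class_C0M D f g : class_C0 D f -> class_C0 D g -> class_C0 D (fun x => f x * g x).
Proof. by move=> cf cg x Dx; exact: (cvgM (cf x Dx) (cg x Dx)). Qed.

Lemma class_C0_cst D a : class_C0 D (fun=> a).
Proof. by move=> x Dx; exact: cst_continuous. Qed.

Lemma class_C0V D f : (forall x, D x -> f x != 0) -> class_C0 D f ->
  class_C0 D (fun x => (f x)^-1).
Proof. by move=> f0 cf x Dx; exact: (cvgV (f0 x Dx) (cf x Dx)). Qed.

Lemma class_C1D D f g : open D -> class_C 1 D f -> class_C 1 D g ->
  class_C 1 D (fun x => f x + g x).
Proof.
move=> Do /class_C1E[cf df] /class_C1E[cg dg]; apply/class_C1E.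
split; first exact: class_C0D.
move=> i; have [d1 c1] := df i; have [d2 c2] := dg i; split=> [x Dx|].
  exact: (derivableD (d1 x Dx) (d2 x Dx)).
apply: class_C0_eq (class_C0D c1 c2) => // x Dx.
by rewrite partialD; [|exact: d1|exact: d2].
Qed.

Lemma class_C1N D f : open D -> class_C 1 D f -> class_C 1 D (fun x => - f x).
Proof.
move=> Do /class_C1E[cf df]; apply/class_C1E.
split; first exact: class_C0N.
move=> i; have [d1 c1] := df i; split=> [x Dx|].
  exact: (derivableN (d1 x Dx)).
apply: class_C0_eq (class_C0N c1) => // x Dx.
by rewrite partialN; last exact: d1.
Qed.

Lemma class_C1M D f g : open D -> class_C 1 D f -> class_C 1 D g ->
  class_C 1 D (fun x => f x * g x).
Proof.
move=> Do /class_C1E[cf df] /class_C1E[cg dg]; apply/class_C1E.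
split; first exact: class_C0M.
move=> i; have [d1 c1] := df i; have [d2 c2] := dg i; split=> [x Dx|].
  exact: (derivableM (d1 x Dx) (d2 x Dx)).
apply: class_C0_eq (class_C0D (class_C0M c1 cg) (class_C0M cf c2)) => // x Dx.
by rewrite partialM; [|exact: d1|exact: d2].
Qed.

Lemma class_C1_cst D a : open D -> class_C 1 D (fun=> a).
Proof.
move=> Do; apply/class_C1E; split; first exact: class_C0_cst.
move=> i; split=> [x Dx|]; first exact: derivable_cst.
apply: class_C0_eq (@class_C0_cst D 0) => // x Dx.
by rewrite partial_cst.
Qed.

Lemma class_C1_sum D (I : Type) (r : seq I) (P : pred I) (F : I -> 'rV[R]_n -> R) :
  open D -> (forall j, class_C 1 D (F j)) ->
  class_C 1 D (fun x => \sum_(j <- r | P j) F j x).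
Proof.
move=> Do CF; elim: r => [|j r IH].
  by under eq_fun do rewrite big_nil; exact: class_C1_cst.
under eq_fun do rewrite big_cons.
by case: (P j); [exact: (class_C1D Do (CF j) IH)|exact: IH].
Qed.

Lemma class_C1_prod D (I : Type) (r : seq I) (P : pred I) (F : I -> 'rV[R]_n -> R) :
  open D -> (forall j, class_C 1 D (F j)) ->
  class_C 1 D (fun x => \prod_(j <- r | P j) F j x).
Proof.
move=> Do CF; elim: r => [|j r IH].
  by under eq_fun do rewrite big_nil; exact: class_C1_cst.
under eq_fun do rewrite big_cons.
by case: (P j); [exact: (class_C1M Do (CF j) IH)|exact: IH].
Qed.

Lemma class_C1V D f : open D -> (forall x, D x -> f x != 0) ->
  class_C 1 D f -> class_C 1 D (fun x => (f x)^-1).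
Proof.
move=> Do f0 /class_C1E[cf df]; apply/class_C1E.
split; first exact: class_C0V.
move=> i; have [d1 c1] := df i; split=> [x Dx|].
  exact: (derivableV (f0 x Dx) (d1 x Dx)).
have cV := class_C0V f0 cf.
apply: class_C0_eq (class_C0N (class_C0M (class_C0M cV cV) c1)) => // x Dx.
rewrite /partial (deriveV (f0 x Dx) (d1 x Dx)).
by rewrite scaleNr expr2 invfM.
Qed.

Lemma class_C1_sqrt D f : open D -> (forall x, D x -> 0 < f x) ->
  class_C 1 D f -> class_C 1 D (fun x => Num.sqrt (f x)).
Proof.
move=> Do f0 /class_C1E[cf df]; apply/class_C1E.
have cs : class_C0 D (fun x => Num.sqrt (f x)).
  by move=> x Dx; apply: continuous_comp; [exact: cf|exact: sqrt_continuous].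
split; first exact: cs.
move=> i; have [d1 c1] := df i.
have s0 x : D x -> Num.sqrt (f x) + Num.sqrt (f x) != 0.
  by move=> Dx; rewrite gt_eqF// addr_gt0// sqrtr_gt0 f0.
have H x : D x ->
  (h^-1 *: (Num.sqrt (f (h *: e_ i + x)) - Num.sqrt (f x))) @[h --> 0^'] -->
   partial i f x * (Num.sqrt (f x) + Num.sqrt (f x))^-1.
  move=> Dx.
  have L : (h *: (e_ i : 'rV[R]_n) + x) @[h --> (0 : R)^'] --> x.
    have : (h *: (e_ i : 'rV[R]_n) + x) @[h --> (0 : R)] --> (0 : R) *: (e_ i : 'rV[R]_n) + x.
      by apply: cvgD; [apply: cvgZr_tmp; exact: cvg_id|exact: cvg_cst].
    rewrite scale0r add0r; apply: cvg_trans; apply: cvg_app; exact: nbhs_dnbhs.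
  (* Rationalisation: the difference quotient of the root is that of [f] divided by the sum of the
     two roots, valid as long as [f] stays positive. *)
  have : (h^-1 *: (f (h *: e_ i + x) - f x)) *
      (Num.sqrt (f (h *: e_ i + x)) + Num.sqrt (f x))^-1 @[h --> 0^'] -->
      partial i f x * (Num.sqrt (f x) + Num.sqrt (f x))^-1.
    apply: cvgM; first exact: (d1 x Dx).
    apply: cvgV; first exact: s0.
    exact: (cvgD (cvg_comp _ _ L (cs x Dx)) (cvg_cst _)).
  apply: cvg_trans; apply: near_eq_cvg; near=> h.
  have fh : 0 < f (h *: e_ i + x).
    near: h; apply: (L [set y | 0 < f y]).
    by apply: (filterS f0); exact: open_nbhs_nbhs.
  rewrite /GRing.scale /= -mulrA; congr (_ * _).
  rewrite -{1}(sqr_sqrtr (ltW fh)) -{1}(sqr_sqrtr (ltW (f0 x Dx))) subr_sqr mulfK//.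
  by rewrite gt_eqF // addr_gt0 ?sqrtr_gt0 // f0.
split=> [x Dx|].
  by apply/cvg_ex; exists (partial i f x * (Num.sqrt (f x) + Num.sqrt (f x))^-1); exact: H.
apply: class_C0_eq (class_C0M c1 (class_C0V s0 (class_C0D cs cs))) => // x Dx.
by apply/esym/cvg_lim => //; exact: H.
Unshelve. all: by end_near. Qed.

End ClassC.

(** * Restriction to lines and uniform continuity on balls *)

Section Lines.
Variables (R : realType) (n : nat).
Implicit Types (f g : 'rV[R]_n -> R) (x y z v : 'rV[R]_n).

Lemma norm_row_le x (a : R) : 0 <= a -> (forall i, `|x 0 i| <= a) -> `|x| <= a.
Proof.
move=> a0 xa; rewrite [leLHS]/Num.norm /= mx_normrE; apply/bigmax_leP; split=> //.
by move=> [i j] _ /=; rewrite ord1.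
Qed.

Lemma norm_delta_le i : `|e_ i : 'rV[R]_n| <= 1.
Proof.
apply: norm_row_le => // j; rewrite mxE eqxx /=.
by case: eqP => _; rewrite ?normr1 ?normr0.
Qed.

Lemma ball_normP x (r : R) y : ball x r y <-> `|x - y| < r.
Proof. by rewrite -ball_normE. Qed.

Lemma ball_shift x (r s : R) i y t : ball x s y -> `|t| + s <= r ->
  ball x r (y + t *: e_ i).
Proof.
move=> /ball_normP xy tsr; apply/ball_normP; rewrite opprD addrA.
apply: le_lt_trans (ler_normB _ _) _.
rewrite normrZ; have := norm_delta_le i; have := normr_ge0 t => t0 d1.
have : `|t| * `|e_ i : 'rV[R]_n| <= `|t| by rewrite -[leRHS]mulr1 ler_wpM2l.
lra.
Qed.

Lemma ball_le x (r s : R) y : s <= r -> ball x s y -> ball x r y.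
Proof. by move=> sr /ball_normP xy; apply/ball_normP; exact: lt_le_trans sr. Qed.

Lemma is_derive_line f x v t : derivable f (x + t *: v) v ->
  is_derive t 1 (fun s : R => f (x + s *: v)) ('D_v f (x + t *: v)).
Proof.
move=> df.
have E : (fun h : R => h^-1 *:
    (((fun s : R => f (x + s *: v)) \o shift t) (h *: 1) - f (x + t *: v)))
   = (fun h : R => h^-1 *: ((f \o shift (x + t *: v)) (h *: v) - f (x + t *: v))).
  apply/funext => h /=; congr (_ *: (f _ - _)).
  by rewrite [h *: 1]mulr1 scalerDl addrCA.
split; first by rewrite /derivable E.
by rewrite /derive E.
Qed.

Lemma MVT_line f x v t : 0 <= t ->
  (forall s, 0 <= s <= t -> derivable f (x + s *: v) v) ->
  exists2 s, 0 <= s <= t & f (x + t *: v) - f x = t * 'D_v f (x + s *: v).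
Proof.
move=> t0 df.
have [||s st E] := @MVT_segment R (fun s => f (x + s *: v))
  (fun s => 'D_v f (x + s *: v)) 0 t t0.
- move=> s; rewrite in_itv /= => /andP[s0 st]; apply: is_derive_line.
  by apply: df; rewrite !ltW.
- apply: derivable_within_continuous => s; rewrite in_itv /= => st.
  by case: (is_derive_line (df s st)).
- exists s; first by move: st; rewrite in_itv.
  by move: E; rewrite scale0r addr0 subr0 mulrC.
Qed.

Lemma compact_closed_ball x0 (s : R) : 0 < s -> compact (closed_ball x0 s).
Proof.
move=> s0; apply: bounded_closed_compact; last exact: closed_ball_closed.
rewrite closed_ballE//; exists (`|x0| + s); split; first exact: num_real.
move=> M HM y /= xy; apply: le_trans (ltW HM).
rewrite -[y](subKr x0); apply: le_trans (ler_normB _ _) _.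
by rewrite lerD2l.
Qed.

(** Heine's theorem on the closed ball of radius [s]. Only [y] is confined to the smaller ball: [z]
    may leave it, as the shifted points under an average do. *)
Lemma ball_unif_continuous f x0 (r s : R) : s < r -> class_C0 (ball x0 r) f ->
  forall eta : R, 0 < eta -> exists2 delta : R, 0 < delta &
  forall y z, ball x0 s y -> `|y - z| < delta -> `|f y - f z| < eta.
Proof.
move=> sr cf eta eta0.
have [s0|s0] := leP s 0.
  exists 1 => // y z /ball_normP; rewrite ltNge (le_trans s0)//.
have cpt := @compact_closed_ball x0 s s0.
have := cpt; rewrite compact_near_coveringP => /(_ R (0 : R)^'+
  (fun d y => forall z, `|y - z| < d -> `|f y - f z| < eta)).
case.
  move=> x; rewrite closed_ballE// => xs.
  have xr : ball x0 r x by apply/ball_normP; exact: le_lt_trans sr.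
  have /cvgrPdist_lt/(_ (eta / 2)) := cf x xr.
  rewrite divr_gt0// => /(_ isT)/nbhs_ballP[eps /= eps0 xe].
  exists (ball x (eps / 2), [set d | d < eps / 2]) => /=.
    split; first by apply: nbhsx_ballx; rewrite divr_gt0.
    by apply: nbhs_right_lt; rewrite divr_gt0.
  move=> [y d] /= [/ball_normP xy de] z yz.
  have e1 : `|f x - f y| < eta / 2.
    by apply: xe; apply/ball_normP; lra.
  have e2 : `|f x - f z| < eta / 2.
    apply: xe; apply/ball_normP; rewrite -(subrKA y).
    by apply: le_lt_trans (ler_normD _ _) _; lra.
  rewrite -(subrKA (f x)) -[X in `|X + _|]opprB; apply: le_lt_trans (ler_normD _ _) _.
  by rewrite normrN; lra.
move=> d /= d0 H; exists (d / 2); first by rewrite divr_gt0.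
move=> y z /ball_normP xy yz.
apply: (H (d / 2)) => //.
- rewrite /= sub0r normrN gtr0_norm ?divr_gt0//.
  by rewrite ltr_pdivrMr// ltr_pMr// ltr1n.
- by rewrite divr_gt0.
- by rewrite closed_ballE//; apply: ltW.
Qed.

Lemma unif_continuous_bounded f x0 (r s : R) : s < r -> class_C0 (ball x0 r) f ->
  exists K : R, 0 < K /\ forall y, ball x0 s y -> `|f y| <= K.
Proof.
move=> sr cf.
have [s0|s0] := leP s 0.
  exists 1; split=> // y /ball_normP; rewrite ltNge (le_trans s0)//.
have /compact_bounded[K [_ HK]] : compact (f @` closed_ball x0 s).
  apply: continuous_compact; last exact: compact_closed_ball.
  apply: continuous_in_subspaceT => x; rewrite inE closed_ballE// => xs.
  by apply: cf; apply/ball_normP; exact: le_lt_trans sr.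
exists (`|K| + 1); split=> [|y /ball_normP ys]; first by rewrite ltr_wpDl.
apply: HK; first by rewrite (le_lt_trans (ler_norm _))// ltrDl.
by exists y => //; rewrite closed_ballE//; apply: ltW.
Qed.

End Lines.

(** * Symmetry of second derivatives *)

Section Schwarz.
Variables (R : realType) (n : nat).
Implicit Types (f g : 'rV[R]_n -> R) (x y z v : 'rV[R]_n).

Lemma derive_shift f a x v :
  (derivable f (x + a) v -> derivable (fun y => f (y + a)) x v) /\
  'D_v (fun y => f (y + a)) x = 'D_v f (x + a).
Proof.
have E : (fun h : R => h^-1 *: (((fun y => f (y + a)) \o shift x) (h *: v) - f (x + a)))
   = (fun h : R => h^-1 *: ((f \o shift (x + a)) (h *: v) - f (x + a))).
  by apply/funext => h /=; rewrite addrA.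
by rewrite /derivable /derive E.
Qed.

(** The mean value theorem is applied to the increment of [f] by t e_j, along e_i, and then to
    [partial i f], along e_j. The second difference is symmetric in i and j, which is what
    [partialC] exploits. *)
Lemma second_difference f x (r t : R) i j :
  class_C 2 (ball x r) f -> 0 < t -> t + t < r ->
  exists2 z, ball x r z /\ `|x - z| <= t + t &
  f (x + t *: e_ i + t *: e_ j) - f (x + t *: e_ i) - f (x + t *: e_ j) + f x
  = t * (t * partial j (partial i f) z).
Proof.
move=> [_ /(_ i) [di [_ /(_ j) [dji _]]]] t0 tr.
have nd k (s : R) : 0 <= s <= t -> `|s *: (e_ k : 'rV[R]_n)| <= t.
  move=> /andP[s0 st]; rewrite normrZ ger0_norm//.
  apply: le_trans st; rewrite -[leRHS]mulr1.
  by apply: ler_wpM2l => //; exact: norm_delta_le.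
have inb (s s' : R) : 0 <= s <= t -> 0 <= s' <= t ->
    `|x - (x + s *: e_ i + s' *: e_ j)| <= t + t.
  move=> st s't; rewrite -addrA opprD addrA subrr sub0r normrN.
  by apply: le_trans (ler_normD _ _) _; apply: lerD; exact: nd.
have inb' (s s' : R) : 0 <= s <= t -> 0 <= s' <= t ->
    ball x r (x + s *: e_ i + s' *: e_ j).
  by move=> st s't; apply/ball_normP; apply: le_lt_trans (inb _ _ st s't) tr.
have t1 : 0 <= t <= t by rewrite lexx ltW.
have t2 : 0 <= (0 : R) <= t by rewrite lexx ltW.
pose phi y := f (y + t *: e_ j) - f y.
have dphi s : 0 <= s <= t -> derivable phi (x + s *: e_ i) (e_ i) /\
   'D_(e_ i) phi (x + s *: e_ i) =
    partial i f (x + s *: e_ i + t *: e_ j) - partial i f (x + s *: e_ i).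
  move=> st; have [d1 e1] := derive_shift f (t *: e_ j) (x + s *: e_ i) (e_ i).
  have d2 : derivable (fun y => f (y + t *: e_ j)) (x + s *: e_ i) (e_ i).
    by apply: d1; apply: di; exact: inb'.
  have d3 : derivable f (x + s *: e_ i) (e_ i).
    by apply: di; have := inb' _ _ st t2; rewrite scale0r addr0.
  split; first exact: derivableB d2 d3.
  by rewrite [LHS](deriveB d2 d3) e1.
have [|s st E1] := @MVT_line R n phi x (e_ i) t (ltW t0).
  by move=> s /dphi[].
have [|s' s't E2] := @MVT_line R n (partial i f) (x + s *: e_ i) (e_ j) t (ltW t0).
  by move=> s' s't; apply: dji; exact: inb'.
exists (x + s *: e_ i + s' *: e_ j).
  by split; [exact: inb'|exact: inb].
rewrite -[partial j _ _]/('D_(e_ j) _ _) -E2 -(dphi s st).2 -E1 /phi.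
rewrite opprB addrA; ring.
Qed.

Lemma dist_split (a b c e : R) :
  `|a - c| < e / 2 -> `|b - c| < e / 2 -> `|a - b| < e.
Proof.
move=> /ltr_normlP[? ?] /ltr_normlP[? ?].
by rewrite ltr_norml; apply/andP; split; lra.
Qed.

Lemma partialC f x (r : R) i j : 0 < r -> class_C 2 (ball x r) f ->
  partial i (partial j f) x = partial j (partial i f) x.
Proof.
move=> r0 Cf.
have cont k l : {for x, continuous (partial k (partial l f))}.
  by case: Cf => _ /(_ l)[_ [_ /(_ k)[_ [+ _]]]]; apply; exact: ballxx.
apply/eqP; rewrite -subr_eq0 -normr_le0; apply/ler_addgt0Pl => eta eta0.
rewrite addr0.
have /cvgrPdist_lt/(_ (eta / 2)) := cont i j.
rewrite divr_gt0// => /(_ isT)/nbhs_ballP[d1 /= d10 H1].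
have /cvgrPdist_lt/(_ (eta / 2)) := cont j i.
rewrite divr_gt0// => /(_ isT)/nbhs_ballP[d2 /= d20 H2].
(* The intermediate points lie within 2t of x, so a third of the smallest radius suffices. *)
pose t := Num.min r (Num.min d1 d2) / 3.
have m0 : 0 < Num.min r (Num.min d1 d2) by rewrite !lt_min r0 d10.
have t0 : 0 < t by rewrite divr_gt0.
have [tr td1 td2] : [/\ t + t < r, t + t < d1 & t + t < d2].
  have : t + t < Num.min r (Num.min d1 d2) by rewrite /t; lra.
  by rewrite !lt_min => /and3P[].
have [z1 [_ z1t] E1] := second_difference i j Cf t0 tr.
have [z2 [_ z2t] E2] := second_difference j i Cf t0 tr.
have S : f (x + t *: e_ i + t *: e_ j) - f (x + t *: e_ i) - f (x + t *: e_ j) + f x =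
    f (x + t *: e_ j + t *: e_ i) - f (x + t *: e_ j) - f (x + t *: e_ i) + f x.
  by congr (_ + _); rewrite [x + t *: e_ i + _]addrAC [LHS]addrAC.
have := etrans (esym E1) (etrans S E2).
move/(mulfI (lt0r_neq0 t0))/(mulfI (lt0r_neq0 t0)) => E.
have z2d : ball x d1 z2 by apply/ball_normP; exact: le_lt_trans z2t td1.
have z1d : ball x d2 z1 by apply/ball_normP; exact: le_lt_trans z1t td2.
have h1 := H1 _ z2d; have h2 := H2 _ z1d; rewrite E in h2.
exact: (ltW (dist_split h1 h2)).
Qed.

End Schwarz.

(** * Approximation by averages *)

Section Mean.
Variable R : realType.
Implicit Types (g k : R -> R).
Let mu := @lebesgue_measure R.

Definition mean g : R := Rintegral mu `[0, 1] g.

Definition cont01 g := forall t : R, 0 <= t <= 1 -> {for t, continuous g}.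

Lemma cont_itv_integrable (a b : R) g :
  (forall t : R, a <= t <= b -> {for t, continuous g}) ->
  mu.-integrable `[a, b] (EFin \o g).
Proof.
move=> cg; apply: continuous_compact_integrable; first exact: segment_compact.
by apply: continuous_in_subspaceT => t; rewrite inE /= in_itv /=; exact: cg.
Qed.

Lemma mean_cst (a : R) : mean (fun=> a) = a.
Proof.
rewrite /mean Rintegral_cst//; have := @lebesgue_measure_itv R `[0, 1]%R.
rewrite /= lte_fin ltr01 oppr0 adde0 => E.
by rewrite [X in fine X]E mulr1.
Qed.

Lemma meanB g k : cont01 g -> cont01 k ->
  mean (fun t => g t - k t) = mean g - mean k.
Proof. by move=> cg ck; rewrite /mean RintegralB//; exact: cont_itv_integrable. Qed.

Lemma meanD g k : cont01 g -> cont01 k ->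
  mean (fun t => g t + k t) = mean g + mean k.
Proof. by move=> cg ck; rewrite /mean RintegralD//; exact: cont_itv_integrable. Qed.

Lemma eq_mean g k : (forall t : R, 0 <= t <= 1 -> g t = k t) -> mean g = mean k.
Proof.
by move=> gk; apply: eq_Rintegral => t; rewrite inE /= in_itv /=; exact: gk.
Qed.

Lemma meanZ (a : R) g : cont01 g -> mean (fun t => a * g t) = a * mean g.
Proof. by move=> cg; rewrite /mean RintegralZl//; exact: cont_itv_integrable. Qed.

Lemma mean_bound (C : R) g : cont01 g -> (forall t : R, 0 <= t <= 1 -> `|g t| <= C) ->
  `|mean g| <= C.
Proof.
move=> cg gC; rewrite ler_norml; apply/andP; split.
  rewrite -[leLHS]mean_cst; apply: le_Rintegral => //.
  - by apply: cont_itv_integrable => t _; exact: cst_continuous.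
  - exact: cont_itv_integrable.
  by move=> t; rewrite /= in_itv /= => /gC; rewrite ler_norml => /andP[].
rewrite -[leRHS]mean_cst; apply: le_Rintegral => //.
- exact: cont_itv_integrable.
- by apply: cont_itv_integrable => t _; exact: cst_continuous.
by move=> t; rewrite /= in_itv /= => /gC; rewrite ler_norml => /andP[].
Qed.

Lemma mean_FTC (K k : R -> R) : (forall t : R, 0 <= t <= 1 -> is_derive t 1 K (k t)) ->
  cont01 k -> mean k = K 1 - K 0.
Proof.
move=> dK ck; rewrite /mean /Rintegral (@continuous_FTC2 R k K 0 1) //.
- by apply: continuous_in_subspaceT => t; rewrite inE /= in_itv /=; exact: ck.
- have cK t : 0 <= t <= 1 -> {for t, continuous K}.
    move=> t01; apply: differentiable_continuous; apply/derivable1_diffP.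
    by case: (dK t t01).
  split.
  + by move=> t; rewrite in_itv /= => /andP[t0 t1]; case: (dK t); rewrite ?ltW.
  + by apply: cvg_at_right_filter; apply: cK; rewrite lexx ler01.
  + by apply: cvg_at_left_filter; apply: cK; rewrite lexx ler01.
- move=> t; rewrite in_itv /= => /andP[t0 t1]; rewrite derive1E.
  by case: (dK t); rewrite ?ltW.
Qed.

Lemma antiderivative g (a b : R) : (forall t : R, a <= t <= b -> {for t, continuous g}) ->
  exists G : R -> R, forall t : R, a < t < b -> is_derive t 1 G (g t).
Proof.
move=> cg; exists (fun s => Rintegral mu `[a, s] g) => t /andP[at_ tb].
have ct : {for t, continuous g} by apply: cg; rewrite !ltW.
have [d e] := continuous_FTC1_closed tb (cont_itv_integrable cg) at_ ct.
by split; rewrite ?derive1E in e *.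
Qed.
End Mean.

Section Steklov.
Variables (R : realType) (n : nat).
Implicit Types (f g : 'rV[R]_n -> R) (x y z v : 'rV[R]_n).

Lemma continuous_line f y v (t : R) : {for y + t *: v, continuous f} ->
  {for t, continuous (fun s : R => f (y + s *: v))}.
Proof.
move=> cf; apply: (@continuous_comp _ _ _ (fun s : R => y + s *: v) f); last exact: cf.
apply: cvgD; first exact: cvg_cst.
by apply: cvgZr_tmp; exact: cvg_id.
Qed.

Lemma ball_nbhs x y (r : R) : ball x r y -> nbhs y (ball x r).
Proof.
move=> xy; apply: open_nbhs_nbhs; split=> //; exact: ball_open.
Qed.

Lemma continuous_line_scaled f y v (a t : R) :
  {for y + (t * a) *: v, continuous f} ->
  {for t, continuous (fun s : R => f (y + (s * a) *: v))}.
Proof.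
have -> : (fun s : R => f (y + (s * a) *: v)) = (fun s : R => f (y + s *: (a *: v))).
  by apply/funext => s; rewrite scalerA.
by rewrite -scalerA; exact: continuous_line.
Qed.

Lemma is_derive_affine (G : R -> R) (a b t l : R) :
  is_derive (b + t * a) 1 G l -> is_derive t 1 (fun u => G (b + u * a)) (l * a).
Proof.
move=> dG.
have dl : is_derive t 1 (fun u : R => b + u * a) a.
  have -> : (fun u : R => b + u * a) = cst b + (a \*: id).
    by apply/funext => u /=; rewrite mulrC.
  by apply: is_derive_eq; rewrite add0r [_ *: _]mulr1.
exact: (@is_derive1_comp R G (fun u => b + u * a) t l a dG dl).
Qed.

Lemma MVT_line_signed f z v (h : R) :
  (forall s : R, `|s| <= `|h| -> derivable f (z + s *: v) v) ->
  exists2 s, `|s| <= `|h| & f (z + h *: v) - f z = h * 'D_v f (z + s *: v).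
Proof.
move=> df; have [h0|h0] := leP 0 h.
  have [|s /andP[s0 sh] E] := @MVT_line R n f z v h h0.
    move=> s /andP[s0 sh]; apply: df.
    by rewrite !ger0_norm.
  by exists s => //; rewrite !ger0_norm.
have nh0 : 0 <= - h by rewrite oppr_ge0 ltW.
have [|s /andP[s0 sh] E] := @MVT_line R n f (z + h *: v) v (- h) nh0.
  move=> s /andP[s0 sh]; rewrite -addrA -scalerDl; apply: df.
  by rewrite (ltr0_norm h0) ler_norml; apply/andP; split; lra.
exists (h + s).
  by rewrite (ltr0_norm h0) ler_norml; apply/andP; split; lra.
move: E; rewrite -!addrA -!scalerDl subrr scale0r addr0 => E.
by apply: oppr_inj; rewrite opprB E mulNr.
Qed.

Variables (x0 : 'rV[R]_n) (r s eps : R) (i : 'I_n).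
Hypotheses (eps0 : 0 < eps) (srs : s + eps < r).

(** The one-sided Steklov average over the segment from y to y + eps e_i. From the ball of radius
    [s] the segment reaches at most radius [s + eps], whence the standing hypothesis [srs]. *)
Definition steklov f y : R := mean (fun t => f (y + (t * eps) *: e_ i)).

Lemma steklov_ball y (t : R) : ball x0 s y -> 0 <= t <= 1 ->
  ball x0 (s + eps) (y + (t * eps) *: e_ i).
Proof.
move=> ys /andP[t0 t1]; apply: ball_shift ys _.
have te : 0 <= t * eps by rewrite mulr_ge0// ltW.
rewrite ger0_norm// addrC lerD2l.
by rewrite ler_piMl// ltW.
Qed.

Lemma steklov_cont01 f y : class_C0 (ball x0 r) f -> ball x0 s y ->
  cont01 (fun t => f (y + (t * eps) *: e_ i)).
Proof.
move=> cf ys t t01.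
apply: continuous_line_scaled; apply: cf.
by apply: ball_le (steklov_ball ys t01); exact: ltW.
Qed.

(** The free constant [c] makes one estimate serve twice: c = f y gives the approximation, c = 0 a
    bound on the average. *)
Lemma steklov_close f y (c eta : R) : class_C0 (ball x0 r) f -> ball x0 s y ->
  (forall z, ball x0 r z -> `|y - z| <= eps -> `|f z - c| <= eta) ->
  `|steklov f y - c| <= eta.
Proof.
move=> cf ys H; have c1 := steklov_cont01 cf ys.
rewrite -[X in _ - X]mean_cst -meanB//; last by move=> t _; exact: cst_continuous.
apply: mean_bound.
  move=> t t01; apply: continuousB; first exact: c1.
  exact: cst_continuous.
move=> t t01; apply: H.
  by apply: ball_le (steklov_ball ys t01); exact: ltW.
rewrite opprD addrA subrr sub0r normrN normrZ; case/andP: t01 => t0 t1.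
have te : 0 <= t * eps by rewrite mulr_ge0// ltW.
rewrite ger0_norm//.
apply: (@le_trans _ _ (1 * eps * 1)); last by rewrite mulr1 mul1r.
apply: ler_pM => //.
  by apply: ler_wpM2r => //; exact: ltW.
exact: norm_delta_le.
Qed.

Lemma steklov_C0 f : class_C0 (ball x0 r) f -> class_C0 (ball x0 s) (steklov f).
Proof.
move=> cf y ys; apply/(@cvgrPdist_le _ _ _ (nbhs y)) => eta eta0.
have [d d0 H] := ball_unif_continuous srs cf eta0.
have N1 := ball_nbhs ys; have N2 : nbhs y (ball y d) by exact: nbhsx_ballx.
apply: filterS (filterI N1 N2) => z [zs /ball_normP yz].
rewrite -meanB; [|exact: steklov_cont01|exact: steklov_cont01].
apply: mean_bound.
  by move=> t t01; apply: continuousB; apply: steklov_cont01.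
move=> t t01; apply: ltW; apply: H; first exact: steklov_ball.
by rewrite opprD addrACA subrr addr0.
Qed.

(** The difference quotient of the average is the average of difference quotients. Each of them is a
    value of [partial j f] at distance at most |h|, by the mean value theorem, so uniform continuity
    controls all of them at once. *)
Lemma steklov_partial f j y :
  class_C 1 (ball x0 r) f -> ball x0 s y ->
  derivable (steklov f) y (e_ j) /\
  partial j (steklov f) y = steklov (partial j f) y.
Proof.
move=> /class_C1E[cf /(_ j)[df cdf]] ys.
suff H : h^-1 *: ((steklov f \o shift y) (h *: e_ j) - steklov f y) @[h --> 0^'] -->
    steklov (partial j f) y.
  by split; [apply/cvg_ex; eexists; exact: H|apply: cvg_lim => //; exact: norm_hausdorff].
apply/cvgrPdist_le => eta eta0.
(* An intermediate radius leaves room for the shift by h. *)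
have sr1 : (s + eps + r) / 2 < r by move: srs => H; lra.
have [d d0 H] := ball_unif_continuous sr1 cdf eta0.
near=> h.
have h0 : h != 0 by near: h; exact: nbhs_dnbhs_neq.
have hd : `|h| < d by near: h; exact: dnbhs0_lt.
have hs : `|h| < (r - s - eps) / 2.
  by near: h; apply: dnbhs0_lt; move: srs => H'; lra.
have inb t u : 0 <= t <= 1 -> `|u| <= `|h| ->
    ball x0 ((s + eps + r) / 2) (y + (t * eps) *: e_ i + u *: e_ j).
  move=> t01 uh; apply: ball_shift (steklov_ball ys t01) _.
  by move: uh hs; lra.
have inb' t u : 0 <= t <= 1 -> `|u| <= `|h| ->
    ball x0 r (y + (t * eps) *: e_ i + u *: e_ j).
  by move=> t01 uh; apply: ball_le (inb t u t01 uh); exact: ltW.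
have hh : `|h| <= `|h| by [].
have z0 : `|(0 : R)| <= `|h| by rewrite normr0.
have c1 := steklov_cont01 cf ys; have c2 := steklov_cont01 cdf ys.
have c3 : cont01 (fun t => f (y + h *: e_ j + (t * eps) *: e_ i)).
  move=> t t01; apply: continuous_line_scaled.
  by apply: cf; rewrite addrAC; exact: inb'.
have cB (g k : R -> R) : cont01 g -> cont01 k -> cont01 (fun t => g t - k t).
  by move=> cg ck t t01; apply: continuousB; [exact: cg|exact: ck].
have cZ (a : R) (g : R -> R) : cont01 g -> cont01 (fun t => a * g t).
  by move=> cg t t01; apply: cvgM; [exact: cvg_cst|exact: cg].
have -> : h^-1 *: ((steklov f \o shift y) (h *: e_ j) - steklov f y) =
  mean (fun t => h^-1 * (f (y + h *: e_ j + (t * eps) *: e_ i) - f (y + (t * eps) *: e_ i))).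
  by rewrite meanZ ?meanB//= ?(addrC (h *: e_ j) y)//; exact: cB.
have c4 := cZ h^-1 _ (cB _ _ c3 c1).
rewrite -meanB//.
apply: mean_bound; first exact: cB.
move=> t t01; rewrite [y + h *: _ + _]addrAC.
have [u uh|u uh ->] := @MVT_line_signed f (y + (t * eps) *: e_ i) (e_ j) h.
  by apply: df; exact: inb'.
rewrite mulKf//; apply: ltW; apply: H.
  by have := inb t 0 t01 z0; rewrite scale0r addr0.
rewrite opprD addrA subrr sub0r normrN normrZ; apply: le_lt_trans hd.
apply: le_trans (ler_wpM2l (normr_ge0 _) (norm_delta_le _ _)) _.
by rewrite mulr1.
Unshelve. all: by end_near. Qed.

(** Here [f] is merely continuous: along its own direction the average is an increment of an
    antiderivative, divided by eps. This is the gain of regularity. *)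
Lemma steklov_partial_dir f y : class_C0 (ball x0 r) f -> ball x0 s y ->
  derivable (steklov f) y (e_ i) /\
  partial i (steklov f) y = eps^-1 * (f (y + eps *: e_ i) - f y).
Proof.
(* Half of the slack [d] is added at each end of [0, eps], so that 0 and eps become interior points,
   where the antiderivative is differentiable. *)
move=> cf ys; pose d := r - s - eps.
have d0 : 0 < d by rewrite /d; move: srs => H; lra.
pose g u := f (y + u *: e_ i).
have cg t : - (d / 2) <= t <= eps + d / 2 -> {for t, continuous g}.
  move=> td; apply: continuous_line; apply: cf; apply: ball_shift ys _.
  have : `|t| <= eps + d / 2.
    by rewrite ler_norml; move: td eps0 d0 => /andP[? ?] ? ?; apply/andP; split; lra.
  by move: d0; rewrite /d => ? ?; lra.
have [G dG] := antiderivative cg.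
have E h : `|h| < d / 2 -> steklov f (y + h *: e_ i) = eps^-1 * (G (h + eps) - G h).
  move=> hd; have {hd} [h1 h2] : - (d / 2) < h /\ h < d / 2.
    by move: hd; rewrite ltr_norml => /andP[].
  have inI t : 0 <= t <= 1 -> - (d / 2) < h + t * eps < eps + d / 2.
    move=> /andP[t0 t1]; have : 0 <= t * eps by rewrite mulr_ge0// ltW.
    have : t * eps <= eps by rewrite ler_piMl// ltW.
    by move: h1 h2 => ? ? ? ?; apply/andP; split; lra.
  have dK (t : R) : 0 <= t <= 1 ->
      is_derive t 1 (fun t => eps^-1 * G (h + t * eps)) (g (h + t * eps)).
    move=> t01; have dGt := is_derive_affine (dG _ (inI t t01)).
    have := is_deriveZ eps^-1 dGt.
    by rewrite [_ *: (_ * _)]mulrC mulfK// gt_eqF.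
  rewrite /steklov (_ : (fun t => _) = (fun t => g (h + t * eps))); last first.
    by apply/funext => t; rewrite /g -addrA -scalerDl.
  rewrite (mean_FTC dK) ?mul1r ?mul0r ?addr0 -?mulrBr//.
  move=> t t01; apply: (@continuous_comp _ _ _ (fun t : R => h + t * eps) g).
    apply: cvgD; first exact: cvg_cst.
    by apply: cvgM; [exact: cvg_id|exact: cvg_cst].
  by apply: cg; have /andP[? ?] := inI t t01; rewrite !ltW.
have dG0 : is_derive (0 : R) 1 G (g 0).
  by apply: dG; move: d0 eps0 => ? ?; apply/andP; split; lra.
have dGe : is_derive (0 : R) 1 (fun h => G (h + eps)) (g eps).
  have : is_derive (eps + 0 * 1) 1 G (g eps).
    by rewrite mul0r addr0; apply: dG; move: d0 eps0 => ? ?; apply/andP; split; lra.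
  move=> /is_derive_affine; rewrite mulr1.
  by have -> : (fun u : R => G (eps + u * 1)) = (fun h => G (h + eps));
    first by apply/funext => u; rewrite mulr1 addrC.
have D : is_derive (0 : R) 1 (fun h => eps^-1 * (G (h + eps) - G h)) (eps^-1 * (g eps - g 0)).
  exact: (is_deriveZ eps^-1 (is_deriveB dGe dG0)).
have {}D : is_derive (0 : R) 1 (fun h => steklov f (y + h *: e_ i)) (eps^-1 * (g eps - g 0)).
  apply: near_eq_is_derive D; near=> h; rewrite E//.
  by near: h; apply: (@nbhs0_lt _ R); rewrite divr_gt0.
case: D => D1 D2.
have F : (fun h : R => h^-1 *:
    (((fun h => steklov f (y + h *: e_ i)) \o shift 0) (h *: 1) -
     steklov f (y + 0 *: e_ i)))
  = (fun h : R => h^-1 *: ((steklov f \o shift y) (h *: e_ i) - steklov f y)).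
  apply/funext => h /=; rewrite scale0r addr0 addr0 [h *: 1]mulr1.
  by rewrite (addrC y).
move: D1 D2; rewrite /derivable /derive F => D1 D2; split => //.
by rewrite /partial [LHS]D2 /g scale0r addr0.
Unshelve. all: by end_near. Qed.

End Steklov.

Section Approximation.
Variables (R : realType) (n : nat).
Implicit Types (f g : 'rV[R]_n -> R) (x y z v : 'rV[R]_n).

Lemma class_C1_shift x0 (r s t : R) i f : class_C 1 (ball x0 r) f ->
  `|t| + s <= r -> class_C 1 (ball x0 s) (fun y => f (y + t *: e_ i)).
Proof.
move=> /class_C1E[cf df] tsr.
have sh g : class_C0 (ball x0 r) g -> class_C0 (ball x0 s) (fun y => g (y + t *: e_ i)).
  move=> cg y ys; apply: (@continuous_comp _ _ _ (fun y => y + t *: e_ i) g).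
    by apply: (@cvgD _ _ _ (nbhs y)); [exact: cvg_id|exact: cvg_cst].
  by apply: cg; exact: (ball_shift _ ys tsr).
apply/class_C1E; split=> [|j]; first exact: sh.
have [dj cj] := df j; split=> [y ys|].
  have [D _] := derive_shift f (t *: e_ i) y (e_ j); apply: D; apply: dj.
  exact: (ball_shift _ ys tsr).
apply: class_C0_eq (sh _ cj) => [|y ys]; first exact: ball_open.
by have [_ D] := derive_shift f (t *: e_ i) y (e_ j).
Qed.

Lemma class_C1Z D (a : R) f : open D -> class_C 1 D f -> class_C 1 D (fun x => a * f x).
Proof. by move=> Do cf; exact: (class_C1M Do (class_C1_cst a Do) cf). Qed.

Lemma class_C1B D f g : open D -> class_C 1 D f -> class_C 1 D g ->
  class_C 1 D (fun x => f x - g x).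
Proof. by move=> Do cf cg; exact: (class_C1D Do cf (class_C1N Do cg)). Qed.

Lemma steklov_C1 x0 (r s eps : R) i f : 0 < eps -> s + eps < r ->
  class_C 1 (ball x0 r) f -> class_C 1 (ball x0 s) (steklov eps i f).
Proof.
move=> e0 srs Cf; have /class_C1E[cf df] := Cf; apply/class_C1E.
split=> [|j]; first exact: steklov_C0 srs _ cf.
split=> [y ys|]; first by have [] := steklov_partial i e0 srs j Cf ys.
have [_ cj] := df j.
apply: (class_C0_eq _ _ (@steklov_C0 _ _ _ _ _ _ i e0 srs _ cj)) => [|y ys].
  exact: ball_open.
by have [] := steklov_partial i e0 srs j Cf ys.
Qed.

(** [P] marks the partial derivatives that are already C^1. They stay so because averaging commutes
    with differentiation, and i joins them because the new partial derivative is a difference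
    quotient of the C^1 function [f]. *)
Lemma steklov_step x0 (r s : R) i (P : pred 'I_n) f (eta : R) : s < r -> 0 < eta ->
  class_C 1 (ball x0 r) f -> (forall j, P j -> class_C 1 (ball x0 r) (partial j f)) ->
  exists w, [/\ class_C 1 (ball x0 s) w,
    (forall j, (j == i) || P j -> class_C 1 (ball x0 s) (partial j w)) &
    forall y, ball x0 s y -> `|w y - f y| <= eta /\
      forall j, `|partial j w y - partial j f y| <= eta].
Proof.
move=> sr eta0 Cf Pf; have /class_C1E[cf df] := Cf.
have [d d0 Hd] := ball_unif_continuous sr cf eta0.
have /choice[dj Hdj] : forall j, exists dj : R, 0 < dj /\
    forall y z, ball x0 s y -> `|y - z| < dj -> `|partial j f y - partial j f z| < eta.
  move=> j; have [_ cj] := df j.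
  by have [d' d'0 H] := ball_unif_continuous sr cj eta0; exists d'.
have [eps [e0 ers ed edj]] : exists eps : R, [/\ 0 < eps, s + eps < r, eps < d &
    forall j, eps < dj j].
  have F : \forall eps \near (0 : R)^'+, [/\ 0 < eps, s + eps < r, eps < d &
      forall j, eps < dj j].
    near=> eps; split.
    - by near: eps; exact: nbhs_right_gt.
    - rewrite addrC -ltrBrDr; near: eps; apply: nbhs_right_lt.
      by rewrite subr_gt0.
    - by near: eps; exact: nbhs_right_lt.
    - near: eps; apply: filter_forall => j.
      by apply: nbhs_right_lt; case: (Hdj j).
  by have [eps He] := @filter_ex _ _ _ _ F; exists eps.
exists (steklov eps i f); split.
- exact: steklov_C1 ers Cf.
- move=> j; have [->{j} _|_ /= Pj] := eqVneq j i.
    have C : class_C 1 (ball x0 s) (fun y => eps^-1 * (f (y + eps *: e_ i) - f y)).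
      apply: class_C1Z; first exact: ball_open.
      apply: class_C1B; first exact: ball_open.
        by apply: class_C1_shift Cf _; rewrite gtr0_norm// addrC ltW.
      by apply: class_C_subset Cf => y; apply: ball_le; exact: ltW.
    apply: class_C_eq C => [|y ys]; first exact: ball_open.
    by have [] := steklov_partial_dir i e0 ers cf ys.
  apply: class_C_eq (steklov_C1 i e0 ers (Pf j Pj)) => [|y ys]; first exact: ball_open.
  by have [] := steklov_partial i e0 ers j Cf ys.
- move=> y ys; split.
    apply: (steklov_close i e0 ers cf ys) => z zr yz.
    by rewrite distrC; apply: ltW; apply: Hd => //; exact: le_lt_trans yz ed.
  move=> j; have [_ ->] := steklov_partial i e0 ers j Cf ys.
  have [_ cj] := df j; apply: (steklov_close i e0 ers cj ys) => z zr yz.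
  rewrite distrC; apply: ltW; apply: (Hdj j).2 => //.
  exact: le_lt_trans yz (edj j).
Unshelve. all: by end_near. Qed.

(* Averaging in the direction i makes the partial derivative along i as smooth
   as the function itself; one average per coordinate gains a derivative. *)
Lemma class_C2_approx x0 (r s : R) f (eta : R) : s < r -> 0 < eta ->
  class_C 1 (ball x0 r) f ->
  exists w, class_C 2 (ball x0 s) w /\
    forall y, ball x0 s y -> `|w y - f y| <= eta /\
      forall j, `|partial j w y - partial j f y| <= eta.
Proof.
move=> sr eta0 Cf.
suff H (l : seq 'I_n) : forall (s : R) (eta : R), s < r -> 0 < eta ->
   exists w, [/\ class_C 1 (ball x0 s) w,
    (forall j, j \in l -> class_C 1 (ball x0 s) (partial j w)) &
    forall y, ball x0 s y -> `|w y - f y| <= eta /\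
      forall j, `|partial j w y - partial j f y| <= eta].
  have [w [C1 C2 cl]] := H (enum 'I_n) s eta sr eta0.
  exists w; split; last exact: cl.
  case: (C1) => c1 d1; split; first exact: c1.
  move=> i; have [di _] := d1 i; split; first exact: di.
  by apply: C2; rewrite mem_enum.
elim: l => [|i l IH] {}s {sr} {}eta {eta0} sr eta0.
  exists f; split=> //; first by apply: class_C_subset Cf => y; apply: ball_le; exact: ltW.
  by move=> y _; rewrite subrr normr0 ltW//; split=> // j; rewrite subrr normr0 ltW.
(* Each coordinate spends half of the remaining gap between the radii and half of the remaining
   tolerance. *)
have s1 : (s + r) / 2 < r by lra.
have s2 : s < (s + r) / 2 by lra.
have e2 : 0 < eta / 2 by rewrite divr_gt0.
have [w1 [C1 C2 cl1]] := IH _ _ s1 e2.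
have [w [C3 C4 cl]] := steklov_step i (P := mem l) s2 e2 C1 C2.
exists w; split=> //.
move=> y ys; have ys1 : ball x0 ((s + r) / 2) y by apply: ball_le ys; exact: ltW.
have [a1 b1] := cl1 y ys1; have [a2 b2] := cl y ys.
have tri (a b c : R) : `|a - b| <= eta / 2 -> `|b - c| <= eta / 2 -> `|a - c| <= eta.
  move=> h1 h2; rewrite -(subrKA b); apply: le_trans (ler_normD _ _) _.
  by rewrite [leRHS]splitr lerD.
by split=> [|j]; [exact: tri a2 a1|exact: tri (b2 j) (b1 j)].
Qed.

End Approximation.

(** * Flux and pointwise divergence *)

Section Flux.
Variables (R : realType) (n : nat) (x0 : 'rV[R]_n) (rho : R).
Hypothesis rho0 : 0 < rho.
Implicit Types (f g : 'rV[R]_n -> R) (x y z v : 'rV[R]_n) (l : seq 'I_n).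

(** When [l] enumerates all indices this is the mean over a cube of side [rho] with corner at the
    point, written as iterated one-variable means. *)
Definition multi_steklov l f := foldr (fun i g => steklov rho i g) f l.

(** One average reaches out by [rho]; the second [rho] provides the strict inequality between radii
    that the averaging lemmas require. *)
Let rad r l : R := r - (size l)%:R * (rho + rho).

Let rad_step r i l : rad r (i :: l) + rho < rad r l.
Proof. by rewrite /rad /= -natr1; move: rho0 => ?; lra. Qed.

Lemma multi_steklov_C0 r l f : class_C0 (ball x0 r) f ->
  class_C0 (ball x0 (rad r l)) (multi_steklov l f).
Proof.
move=> cf; elim: l => [|i l IH].
  by rewrite /rad /= mul0r subr0.
exact: (@steklov_C0 _ _ _ _ _ _ i rho0 (rad_step r i l) _ IH).
Qed.

Lemma multi_steklov_C1 r l f : class_C 1 (ball x0 r) f ->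
  class_C 1 (ball x0 (rad r l)) (multi_steklov l f).
Proof.
move=> cf; elim: l => [|i l IH].
  by rewrite /rad /= mul0r subr0.
exact: (steklov_C1 i rho0 (rad_step r i l) IH).
Qed.

Lemma multi_steklov_close r l f (c a : R) : class_C0 (ball x0 r) f ->
  (forall y, ball x0 r y -> `|f y - c| <= a) ->
  forall y, ball x0 (rad r l) y -> `|multi_steklov l f y - c| <= a.
Proof.
move=> cf fa; elim: l => [|i l IH] y.
  by rewrite /rad /= mul0r subr0; exact: fa.
move=> ys; rewrite -[multi_steklov _ _]/(steklov rho i (multi_steklov l f)).
apply: (steklov_close i rho0 (rad_step r i l) (@multi_steklov_C0 r l _ cf) ys).
by move=> z zr _; exact: IH.
Qed.

Lemma multi_steklovD r l f g : class_C0 (ball x0 r) f -> class_C0 (ball x0 r) g ->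
  forall y, ball x0 (rad r l) y ->
  multi_steklov l (fun y => f y + g y) y = multi_steklov l f y + multi_steklov l g y.
Proof.
move=> cf cg; elim: l => [//|i l IH] y ys.
have st := rad_step r i l.
rewrite /= {1}/steklov (eq_mean (k := fun t =>
  multi_steklov l f (y + (t * rho) *: e_ i) + multi_steklov l g (y + (t * rho) *: e_ i))).
  have c1 := steklov_cont01 (i:=i) rho0 st (@multi_steklov_C0 r l _ cf) ys.
  have c2 := steklov_cont01 (i:=i) rho0 st (@multi_steklov_C0 r l _ cg) ys.
  exact: (meanD c1 c2).
move=> t t01; apply: IH; apply: ball_le (steklov_ball i rho0 ys t01).
exact: ltW.
Qed.

Lemma multi_steklov_partial r l f j : class_C 1 (ball x0 r) f ->
  forall y, ball x0 (rad r l) y ->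
  partial j (multi_steklov l f) y = multi_steklov l (partial j f) y.
Proof.
move=> cf; elim: l => [//|i l IH] y ys.
have st := rad_step r i l.
have [_ ->] := steklov_partial i rho0 st j (multi_steklov_C1 l cf) ys.
apply: eq_mean => t t01; apply: IH; apply: ball_le (steklov_ball i rho0 ys t01).
exact: ltW.
Qed.

(* Averaging a partial derivative over a segment of length rho in the same
   direction leaves a difference quotient. *)
Lemma multi_steklov_partial_bound r l f j (a : R) : class_C 1 (ball x0 r) f ->
  (forall y, ball x0 r y -> `|f y| <= a) -> j \in l ->
  forall y, ball x0 (rad r l) y ->
  `|multi_steklov l (partial j f) y| <= (a + a) / rho.
Proof.
move=> Cf fa; have /class_C1E[cf /(_ j)[_ cdf]] := Cf.
elim: l => [//|i l IH]; rewrite inE => jl y ys.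
have st := rad_step r i l.
have [ij|ij] := eqVneq j i.
  have fl z : ball x0 (rad r l) z -> `|multi_steklov l f z| <= a.
    move=> zl; rewrite -[X in `|X|]subr0; apply: multi_steklov_close cf _ _ zl.
    by move=> w; rewrite subr0; exact: fa.
  have [_] := steklov_partial_dir i rho0 st (@multi_steklov_C0 r l _ cf) ys.
  have [_ ->] := steklov_partial i rho0 st i (multi_steklov_C1 l Cf) ys.
  have -> : steklov rho i (partial i (multi_steklov l f)) y =
            multi_steklov (i :: l) (partial j f) y.
    apply: eq_mean => t t01; rewrite ij; apply: multi_steklov_partial Cf _ _.
    by apply: ball_le (steklov_ball i rho0 ys t01); exact: ltW.
  move=> ->; rewrite mulrC normrM normfV (gtr0_norm rho0).
  apply: ler_wpM2r; first by rewrite invr_ge0 ltW.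
  apply: le_trans (ler_normB _ _) _; apply: lerD; apply: fl.
    apply: ball_shift ys _; rewrite gtr0_norm// addrC.
    exact: ltW.
  by apply: ball_le ys; move: st rho0 => ? ?; lra.
have {jl}jl : j \in l by move: jl; rewrite (negbTE ij).
rewrite -[multi_steklov _ _]/(steklov rho i (multi_steklov l (partial j f))).
rewrite -[X in `|X|]subr0.
apply: (steklov_close i rho0 st (@multi_steklov_C0 r l _ cdf) ys) => z zr _.
by rewrite subr0; exact: IH.
Qed.

(** The divergence theorem on a cube of side [rho]: the mean divergence is within [b] of [c], and
    each of the n pairs of opposite faces contributes at most 2a / rho to it. *)
Lemma flux_bound (Z : 'I_n -> 'rV[R]_n -> R) (r a b c : R) :
  n%:R * (rho + rho) < r ->
  (forall i, class_C 1 (ball x0 r) (Z i)) ->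
  (forall i y, ball x0 r y -> `|Z i y| <= a) ->
  (forall y, ball x0 r y -> `|\sum_i partial i (Z i) y - c| <= b) ->
  `|c| <= b + n%:R * ((a + a) / rho).
Proof.
move=> nr CZ Za Zb; pose l := enum 'I_n.
have cZ i : class_C0 (ball x0 r) (partial i (Z i)).
  by have /class_C1E[_ /(_ i)[]] := CZ i.
have sz : size l = n by rewrite size_enum_ord.
have bx : ball x0 (rad r l) x0 by apply: ballxx; rewrite /rad sz subr_gt0.
have cs (s : seq 'I_n) : class_C0 (ball x0 r) (fun y => \sum_(i <- s) partial i (Z i) y).
  elim: s => [|i s IH]; first by under eq_fun do rewrite big_nil; exact: class_C0_cst.
  by under eq_fun do rewrite big_cons; exact: class_C0D.
have E (s : seq 'I_n) :
    `|multi_steklov l (fun y => \sum_(i <- s) partial i (Z i) y) x0| <=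
    (size s)%:R * ((a + a) / rho).
  elim: s => [|i s IH].
    rewrite mul0r -[X in `|X|]subr0; apply: multi_steklov_close bx => //.
    by move=> y _; rewrite big_nil subr0 normr0.
  under eq_fun do rewrite big_cons.
  rewrite (multi_steklovD (cZ i) (cs s) bx) /= -nat1r mulrDl mul1r.
  apply: le_trans (ler_normD _ _) _; apply: lerD => //.
  apply: multi_steklov_partial_bound bx => //; first exact: Za.
  by rewrite mem_enum.
have := multi_steklov_close (cs (index_enum 'I_n)) Zb bx.
have := E (index_enum 'I_n).
rewrite (_ : size (index_enum 'I_n) = n); last first.
  by rewrite -[LHS]sum1_size big_const_ord iter_addn_0 mul1n.
set T := multi_steklov _ _ _ => h1 h2.
rewrite -[X in `|X|](subKr T); apply: le_trans (ler_normB _ _) _.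
by rewrite addrC; apply: lerD.
Qed.

End Flux.

Section DivergenceLimit.
Variables (R : realType) (n : nat).
Implicit Types (V : 'rV[R]_n -> 'cV[R]_n) (x y : 'rV[R]_n).

Lemma ler_col_norm (v : 'cV[R]_n) i : `|v i 0| <= `|v|.
Proof.
by rewrite [leRHS]/Num.norm /= mx_normrE; apply/bigmax_geP; right => /=; exists (i, 0).
Qed.

Lemma differentiable_expansion V x (eta : R) : differentiable V x -> 0 < eta ->
  exists2 d : R, 0 < d & forall y, ball x d y -> forall i,
  `|V y i 0 - V x i 0 - \sum_j (y 0 j - x 0 j) * partial j (fun z => V z i 0) x|
  <= eta * `|x - y|.
Proof.
move=> dV eta0.
have E y i : \sum_j (y 0 j - x 0 j) * partial j (fun z => V z i 0) x
    = ('d V x (y - x)) i 0.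
  rewrite [X in 'd V x X]matrix_sum_delta big_ord1 linear_sum summxE.
  apply: eq_bigr => j _; rewrite linearZ !mxE; congr (_ * _).
  have dj : derivable V x (e_ j) by exact: diff_derivable.
  by rewrite -(deriveE (e_ j) dV) (derive_mx dj) mxE.
have [_ ] := (diff_locallyP x V).1 dV.
move=> /eqaddoP/(_ _ eta0)/nbhs_ballP[d /= d0 Hd].
exists d => // y /ball_normP xy i; rewrite E.
have := Hd (y - x); rewrite -ball_normE /= sub0r opprB => /(_ xy).
rewrite (distrC x y) => H; apply: le_trans H.
apply: le_trans (ler_col_norm _ i).
by rewrite !fctE /= subrK !mxE opprD addrA.
Qed.

Lemma is_derive_coord (x : 'rV[R]_n) i j :
  is_derive x (e_ i) (fun y : 'rV[R]_n => y 0 j) ((j == i)%:R).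
Proof.
have E : (fun h : R => h^-1 *: (((fun y : 'rV[R]_n => y 0 j) \o shift x) (h *: e_ i) - x 0 j))
     @ (0 : R)^' --> ((j == i)%:R : R).
  apply: cvg_near_cst; near=> h.
  have h0 : h != 0 by near: h; exact: nbhs_dnbhs_neq.
  by rewrite /= !mxE eqxx /= addrK eq_sym [_ *: _]mulKf.
by apply: DeriveDef; [apply/cvg_ex; eexists; exact: E|apply: cvg_lim => //].
Unshelve. all: by end_near. Qed.

Lemma class_C1_coord D (j : 'I_n) : open D -> class_C 1 D (fun y : 'rV[R]_n => y 0 j).
Proof.
move=> Do; apply/class_C1E; split=> [x Dx|i].
  exact: (@matrix_normedtype.coord_continuous R 1 n 0 j x).
split=> [x Dx|]; first by case: (is_derive_coord x i j).
apply: (class_C0_eq _ _ (@class_C0_cst _ _ D (j == i)%:R)) => // x Dx.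
by case: (is_derive_coord x i j) => _ <-.
Qed.

Lemma partial_affine i (a : R) (b c : 'I_n -> R) x :
  partial i (fun y => a + \sum_j (y 0 j - b j) * c j) x = c i.
Proof.
have dc (j : 'I_n) : derivable (fun y : 'rV[R]_n => y 0 j) x (e_ i) /\
    partial i (fun y : 'rV[R]_n => y 0 j) x = (j == i)%:R.
  by case: (is_derive_coord x i j).
have dk (k : R) : derivable (fun _ : 'rV[R]_n => k) x (e_ i) by exact: derivable_cst.
have db (j : 'I_n) : derivable (fun y : 'rV[R]_n => y 0 j - b j) x (e_ i).
  exact: (derivableB (dc j).1 (dk (b j))).
have dt (j : 'I_n) : derivable (fun y : 'rV[R]_n => (y 0 j - b j) * c j) x (e_ i).
  exact: (derivableM (db j) (dk (c j))).
have [ds es] := partial_sum (index_enum 'I_n) xpredT dt.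
have pt (j : 'I_n) : partial i (fun y => (y 0 j - b j) * c j) x = (j == i)%:R * c j.
  rewrite (partialM (db j) (dk _)) partial_cst mulr0 addr0.
  by rewrite (partialD (dc j).1 (dk _)) partial_cst addr0 (dc j).2.
rewrite (partialD (dk _) ds) partial_cst add0r es (bigD1 i) //= pt eqxx mul1r.
by rewrite big1 ?addr0// => j /negbTE ji; rewrite pt ji mul0r.
Qed.

Lemma class_C1_affine D (a : R) (b c : 'I_n -> R) : open D ->
  class_C 1 D (fun y => a + \sum_j (y 0 j - b j) * c j).
Proof.
move=> Do; apply: (class_C1D Do (class_C1_cst a Do)).
apply: (class_C1_sum _ _ Do) => j; apply: (class_C1M Do _ (class_C1_cst _ Do)).
exact: (class_C1B Do (class_C1_coord j Do) (class_C1_cst _ Do)).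
Qed.

(* At a point where a continuous field is differentiable, its classical
   divergence is its distributional one: subtract the first order expansion and
   compare fluxes through small cubes. *)
Lemma divergence_limit V (F : 'rV[R]_n -> R) x0 (r : R) : 0 < r ->
  differentiable V x0 -> {for x0, continuous F} ->
  (forall eta : R, 0 < eta -> exists Y : 'I_n -> 'rV[R]_n -> R,
    (forall i, class_C 1 (ball x0 r) (Y i)) /\
    forall y, ball x0 r y -> (forall i, `|Y i y - V y i 0| <= eta) /\
      `|\sum_i partial i (Y i) y - F y| <= eta) ->
  \sum_i partial i (fun y => V y i 0) x0 = F x0.
Proof.
move=> r0 dV cF H.
pose L i j := partial j (fun y => V y i 0) x0.
pose N : R := n%:R.
have N0 : 0 <= N by exact: ler0n.
(* The constant is what [flux_bound] yields for b = 2 eta, a = 2 eta q and rho = q / (2 (N + 1)):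
   the flux term is N (4 eta q) / rho = 8 N (N + 1) eta. *)
suff K (eta : R) : 0 < eta ->
    `|\sum_i L i i - F x0| <= (2 + 8 * N * (N + 1)) * eta.
  apply/eqP; rewrite -subr_eq0 -normr_le0; apply/ler_addgt0Pl => e e0.
  have C0 : 0 < 2 + 8 * N * (N + 1) by rewrite ltr_wpDr// !mulr_ge0// addr_ge0.
  have := K (e / (2 + 8 * N * (N + 1))); rewrite divr_gt0// => /(_ isT).
  by rewrite mulrC divfK ?gt_eqF// addr0.
move=> eta0; have [d d0 Hd] := differentiable_expansion dV eta0.
have /cvgrPdist_lt/(_ _ eta0)/nbhs_ballP[d' /= d'0 Hd'] := cF.
pose q := Num.min r (Num.min d d').
have q0 : 0 < q by rewrite !lt_min r0 d0.
have [qr qd qd'] : [/\ q <= r, q <= d & q <= d'] by rewrite !ge_min !lexx !orbT.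
(* The values of the field must be close even relative to [q], since the flux estimate divides them
   by a multiple of [q]. *)
have [Y [CY HY]] := H (Num.min eta (eta * q)) ltac:(by rewrite lt_min eta0 mulr_gt0).
(* Then n (2 rho) = q N / (N + 1) < q, as [flux_bound] demands. *)
pose rho := q / (2 * (N + 1)).
have N1 : 0 < 2 * (N + 1) by rewrite mulr_gt0// ltr_wpDl.
have rho0 : 0 < rho by rewrite divr_gt0.
(* Removing the first order expansion of [V] at [x0] makes the field of size eta q on the ball of
   radius q, and lowers the divergence by the constant trace of [L]. *)
pose Z i y := Y i y - (V x0 i 0 + \sum_j (y 0 j - x0 0 j) * L i j).
have sub y : ball x0 q y -> ball x0 r y by exact: ball_le.
have /(_ (eta * q + eta * q) (eta + eta) (F x0 - \sum_i L i i)) :=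
  @flux_bound R n x0 rho rho0 Z q.
rewrite distrC => /(_ _ _ _ _)/le_trans; apply.
- have -> : rho + rho = q / (N + 1) by rewrite /rho; field; rewrite gt_eqF// ltr_wpDl.
  by rewrite mulrA ltr_pdivrMr ?ltr_wpDl// mulrC ltr_pM2l// ltrDl.
- move=> i; apply: class_C1B; first exact: ball_open.
    by apply: class_C_subset (CY i).
  apply: class_C1_affine; exact: ball_open.
- move=> i y yq; have [/(_ i) h1 _] := HY y (sub y yq).
  have h2 := Hd y (ball_le qd yq) i.
  have -> : Z i y = (Y i y - V y i 0) +
      (V y i 0 - V x0 i 0 - \sum_j (y 0 j - x0 0 j) * L i j) by rewrite /Z; ring.
  apply: le_trans (ler_normD _ _) _; apply: lerD.
    by apply: le_trans h1 _; rewrite ge_min lexx orbT.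
  apply: le_trans h2 _; apply: ler_wpM2l; first exact: ltW.
  by apply: ltW; exact/ball_normP.
- move=> y yq; have [_ h1] := HY y (sub y yq).
  have -> : \sum_i partial i (Z i) y = \sum_i partial i (Y i) y - \sum_i L i i.
    rewrite -sumrB; apply: eq_bigr => i _.
    have /class_C1E[_ /(_ i)[dY _]] := CY i.
    have Do : open (ball x0 r) by exact: ball_open.
    have /class_C1E[_ /(_ i)[dA _]] := class_C1_affine (V x0 i 0) (x0 0) (L i) Do.
    have Dy := sub y yq.
    rewrite /Z (partialD (dY y Dy) (derivableN (dA y Dy))).
    by rewrite (partialN (dA y Dy)) partial_affine.
  have h2 := Hd' y (ball_le qd' yq).
  rewrite opprB addrA subrK -(subrKA (F y)).
  apply: le_trans (ler_normD _ _) _; apply: lerD.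
    by apply: le_trans h1 _; rewrite ge_min lexx.
  by rewrite distrC; exact: ltW.
- rewrite le_eqVlt; apply/orP; left; apply/eqP.
  by rewrite /rho -/N; field; rewrite !gt_eqF// ltr_wpDl.
Qed.

End DivergenceLimit.

(** * Covariant calculus in a chart *)

Section MatrixFields.
Variables (R : realType) (n : nat) (D : set 'rV[R]_n).
Hypothesis Do : open D.

Definition mx_C1 m p (B : 'rV[R]_n -> 'M[R]_(m, p)) :=
  forall a b, class_C 1 D (fun y => B y a b).

Definition dmx m p (j : 'I_n) (B : 'rV[R]_n -> 'M[R]_(m, p)) y : 'M[R]_(m, p) :=
  \matrix_(a, b) partial j (fun z => B z a b) y.

Lemma derivable_const (a : R) (y v : 'rV[R]_n) : derivable (fun=> a) y v.
Proof. exact: derivable_cst. Qed.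

Lemma class_C1_derivable f j y : class_C 1 D f -> D y -> derivable f y (e_ j).
Proof. by move=> /class_C1E[_ /(_ j)[d _]]; exact: d. Qed.

Lemma eq_partial f g j y : D y -> (forall z, D z -> f z = g z) ->
  partial j f y = partial j g y.
Proof. by move=> Dy fg; apply: near_eq_derive; exact: open_near_eq Dy fg. Qed.

Lemma eq_dmx m p j (B C : 'rV[R]_n -> 'M[R]_(m, p)) y : D y ->
  (forall z, D z -> B z = C z) -> dmx j B y = dmx j C y.
Proof.
by move=> Dy BC; apply/matrixP => a b; rewrite !mxE; apply: eq_partial => // z /BC ->.
Qed.

Lemma mx_C1_eq m p (B C : 'rV[R]_n -> 'M[R]_(m, p)) :
  (forall z, D z -> B z = C z) -> mx_C1 B -> mx_C1 C.
Proof. by move=> BC CB a b; apply: class_C_eq (CB a b) => // z /BC ->. Qed.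

Lemma mx_C1M m p q (B : 'rV[R]_n -> 'M[R]_(m, p)) (C : 'rV[R]_n -> 'M[R]_(p, q)) :
  mx_C1 B -> mx_C1 C -> mx_C1 (fun y => B y *m C y).
Proof.
move=> CB CC a b; under eq_fun do rewrite mxE.
apply: (class_C1_sum _ _ Do) => k; exact: (class_C1M Do (CB a k) (CC k b)).
Qed.

Lemma mx_C1D m p (B C : 'rV[R]_n -> 'M[R]_(m, p)) :
  mx_C1 B -> mx_C1 C -> mx_C1 (fun y => B y + C y).
Proof. by move=> CB CC a b; under eq_fun do rewrite mxE; exact: class_C1D. Qed.

Lemma mx_C1N m p (B : 'rV[R]_n -> 'M[R]_(m, p)) :
  mx_C1 B -> mx_C1 (fun y => - B y).
Proof. by move=> CB a b; under eq_fun do rewrite mxE; exact: class_C1N. Qed.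

Lemma mx_C1_scalar m f : class_C 1 D f -> mx_C1 (fun y => (f y)%:M : 'M[R]_m).
Proof.
move=> Cf a b; under eq_fun do rewrite mxE.
case: (a == b); [exact: Cf|exact: class_C1_cst Do].
Qed.

Lemma mx_C1_cst m p (B : 'M[R]_(m, p)) : mx_C1 (fun=> B).
Proof. by move=> a b; exact: class_C1_cst. Qed.

Lemma class_C1_trace m (B : 'rV[R]_n -> 'M[R]_m) : mx_C1 B ->
  class_C 1 D (fun y => \tr (B y)).
Proof. by move=> CB; apply: class_C1_sum. Qed.

Lemma class_C1_det m (B : 'rV[R]_n -> 'M[R]_m) : mx_C1 B ->
  class_C 1 D (fun y => \det (B y)).
Proof.
move=> CB; apply: (class_C1_sum _ _ Do) => s; apply: (class_C1M Do).
  exact: class_C1_cst Do.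
by apply: (class_C1_prod _ _ Do) => i; exact: CB.
Qed.

Lemma mx_C1_invmx m (B : 'rV[R]_n -> 'M[R]_m) : (forall y, D y -> B y \in unitmx) ->
  mx_C1 B -> mx_C1 (fun y => invmx (B y)).
Proof.
move=> Bu CB.
apply: (@mx_C1_eq _ _ (fun y => (\det (B y))^-1 *: \adj (B y))).
  by move=> z /Bu Bz; rewrite /invmx Bz.
move=> a b; under eq_fun do rewrite !mxE.
apply: (class_C1M Do).
  apply: (class_C1V Do); last exact: class_C1_det.
  by move=> y /Bu; rewrite unitmxE unitfE.
apply: (class_C1M Do); first exact: class_C1_cst Do.
apply: class_C1_det => i j; under eq_fun do rewrite !mxE.
exact: CB.
Qed.

Lemma dmxM m p q j (B : 'rV[R]_n -> 'M[R]_(m, p)) (C : 'rV[R]_n -> 'M[R]_(p, q)) y :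
  mx_C1 B -> mx_C1 C -> D y ->
  dmx j (fun y => B y *m C y) y = dmx j B y *m C y + B y *m dmx j C y.
Proof.
move=> CB CC Dy; apply/matrixP => a b; rewrite !mxE -big_split /=.
under [in LHS]eq_fun do rewrite mxE.
have db k : derivable (fun z => B z a k * C z k b) y (e_ j).
  by apply: class_C1_derivable Dy; apply: class_C1M.
rewrite (partial_sum _ _ db).2; apply: eq_bigr => k _; rewrite !mxE.
by rewrite (partialM (class_C1_derivable (CB a k) Dy) (class_C1_derivable (CC k b) Dy)).
Qed.

Lemma dmxD m p j (B C : 'rV[R]_n -> 'M[R]_(m, p)) y :
  mx_C1 B -> mx_C1 C -> D y ->
  dmx j (fun y => B y + C y) y = dmx j B y + dmx j C y.
Proof.
move=> CB CC Dy; apply/matrixP => a b; rewrite !mxE.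
under [in LHS]eq_fun do rewrite mxE.
by rewrite (partialD (class_C1_derivable (CB a b) Dy) (class_C1_derivable (CC a b) Dy)).
Qed.

Lemma dmxN m p j (B : 'rV[R]_n -> 'M[R]_(m, p)) y : mx_C1 B -> D y ->
  dmx j (fun y => - B y) y = - dmx j B y.
Proof.
move=> CB Dy; apply/matrixP => a b; rewrite !mxE.
under [in LHS]eq_fun do rewrite mxE.
by rewrite (partialN (class_C1_derivable (CB a b) Dy)).
Qed.

Lemma dmx_scalar m j f y : dmx j (fun y => (f y)%:M : 'M[R]_m) y = (partial j f y)%:M.
Proof.
apply/matrixP => a b; rewrite !mxE; under [in LHS]eq_fun do rewrite mxE.
case: (a == b) => /=; last by under [in LHS]eq_fun do rewrite mulr0n; exact: partial_cst.
by under [in LHS]eq_fun do rewrite mulr1n.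
Qed.

Lemma dmx_cst m p j (B : 'M[R]_(m, p)) y : dmx j (fun=> B) y = 0.
Proof. by apply/matrixP => a b; rewrite !mxE partial_cst. Qed.

Lemma partial_trace m j (B : 'rV[R]_n -> 'M[R]_m) y : mx_C1 B -> D y ->
  partial j (fun y => \tr (B y)) y = \tr (dmx j B y).
Proof.
move=> CB Dy; have db k : derivable (fun z => B z k k) y (e_ j).
  exact: class_C1_derivable Dy.
by rewrite (partial_sum _ _ db).2; apply: eq_bigr => k _; rewrite mxE.
Qed.

Lemma newton_poly_C1 (A : 'rV[R]_n -> 'M[R]_n) r : mx_C1 A ->
  class_C 1 D (fun y => sigma r (A y)) /\ mx_C1 (fun y => newton_poly r (A y)).
Proof.
move=> CA; elim: r => [|r [_ IH]].
  by split; [exact: class_C1_cst|exact: mx_C1_cst].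
have C1 : mx_C1 (fun y => A y *m newton_poly r (A y)) by exact: mx_C1M.
have C2 : class_C 1 D (fun y => sigma r.+1 (A y)).
  under eq_fun do rewrite sigmaS.
  exact: (class_C1M Do (class_C1_trace C1) (class_C1_cst _ Do)).
split; first exact: C2.
exact: (mx_C1D (mx_C1_scalar C2) (mx_C1N C1)).
Qed.

Lemma partial_newton_poly (A : 'rV[R]_n -> 'M[R]_n) r j y : mx_C1 A -> D y ->
  partial j (fun y => sigma r (A y)) y = dsigma r (A y) (dmx j A y) /\
  dmx j (fun y => newton_poly r (A y)) y = dnewton r (A y) (dmx j A y).
Proof.
move=> CA Dy; elim: r => [|r [_ IH]].
  by split; [exact: partial_cst|exact: dmx_cst].
have [_ CN] := newton_poly_C1 r CA; have [CS _] := newton_poly_C1 r.+1 CA.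
have C1 : mx_C1 (fun y => A y *m newton_poly r (A y)) by exact: mx_C1M.
have E : partial j (fun y => sigma r.+1 (A y)) y = dsigma r.+1 (A y) (dmx j A y).
  under eq_fun do rewrite sigmaS.
  have dT := class_C1_derivable (j:=j) (class_C1_trace C1) Dy.
  rewrite (partialM dT (@derivable_const (r.+1%:R^-1) y (e_ j))).
  by rewrite partial_cst mulr0 addr0 (partial_trace j C1 Dy) (dmxM j CA CN Dy) IH dsigmaS.
split; first exact: E.
rewrite (dmxD j (mx_C1_scalar CS) (mx_C1N C1) Dy).
by rewrite dmx_scalar E (dmxN j C1 Dy) (dmxM j CA CN Dy) IH dnewtonS.
Qed.

End MatrixFields.

(** The differential of A P_r = P_r A, for an arbitrary direction [dA]. It is used to bring [A] to
    the right of dP_r. *)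
Lemma dnewton_comm (F : numFieldType) n (A dA : 'M[F]_n) r :
  dA *m newton_poly r A + A *m dnewton r A dA
  = dnewton r A dA *m A + newton_poly r A *m dA.
Proof.
elim: r => [|r IH].
  by rewrite /newton_poly /dnewton /= mulmx0 mul0mx mulmx1 mul1mx addr0 add0r.
rewrite newton_polyS dnewtonS {1}IH !(mulmxBr, mulmxBl, mulmxDr, mulmxDl).
rewrite -!scalar_mxC !mulmxA newton_poly_comm -!mulmxA newton_poly_comm.
set a1 := dA *m _%:M; set a2 := dA *m (_ *m _); set a3 := A *m _%:M.
set a4 := A *m (_ *m _); set a5 := newton_poly _ _ *m _.
by rewrite !opprD addrACA [RHS]addrACA [a1 + a3]addrC !addrA.
Qed.

Section Geometry.
Variables (R : realType) (n : nat) (D : set 'rV[R]_n) (h : 'rV[R]_n -> 'M[R]_n).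
Hypotheses (Do : open D) (h_sym : forall y, D y -> (h y)^T = h y)
  (h_unit : forall y, D y -> h y \in unitmx)
  (h_C2 : forall a b, class_C 2 D (fun y => h y a b)).

(** The connection matrix in direction j: the covariant derivative of a column field [V] is
    [dmx j V + Gam j *m V]. *)
Definition Gam j y : 'M[R]_n := \matrix_(k, i) christoffel h y k j i.

Lemma h_C1 : mx_C1 D h.
Proof. by move=> a b; apply: class_CS. Qed.

Lemma Gam_C1 j : mx_C1 D (Gam j).
Proof.
move=> k i; under eq_fun do rewrite mxE.
have dh a b c : class_C 1 D (partial a (fun y => h y b c)).
  by have [_ /(_ a)[]] := h_C2 b c.
apply: (class_C1M Do); first exact: class_C1_cst Do.
apply: (class_C1_sum _ _ Do) => l; apply: (class_C1M Do).
  exact: (mx_C1_invmx Do h_unit h_C1).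
exact: (class_C1B Do (class_C1D Do (dh _ _ _) (dh _ _ _)) (dh _ _ _)).
Qed.

Lemma christoffel_sym y k i j : D y -> christoffel h y k i j = christoffel h y k j i.
Proof.
move=> Dy; rewrite /christoffel; congr (_ * _); apply: eq_bigr => l _.
have -> : partial l (fun z => h z i j) y = partial l (fun z => h z j i) y.
  by apply: (eq_partial Do _ Dy) => z Dz; rewrite -{1}(h_sym Dz) mxE.
by rewrite [X in _ * (X - _)]addrC.
Qed.

Lemma nablaE V y j : col j (nabla h V y) = dmx j V y + Gam j y *m V y.
Proof.
apply/colP => k; rewrite !mxE; congr (_ + _).
by apply: eq_bigr => i _; rewrite mxE.
Qed.

(** With the sign convention in force this is the matrix of R(e_k, e_j), with the indices in reverse
    order. *)
Definition curv j k y : 'M[R]_n :=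
  dmx j (Gam k) y + Gam j y *m Gam k y - (dmx k (Gam j) y + Gam k y *m Gam j y).

Lemma nabla_mul V y (v : 'cV[R]_n) :
  nabla h V y *m v = \sum_j v j 0 *: (dmx j V y + Gam j y *m V y).
Proof.
apply/colP => k; rewrite summxE mxE; apply: eq_bigr => j _.
rewrite -nablaE; rewrite [RHS]mxE [in RHS]mxE mulrC.
by [].
Qed.

Lemma cov_cst (v z : 'cV[R]_n) y :
  cov h (cst v) (cst z) y = \sum_k v k 0 *: (Gam k y *m z).
Proof.
rewrite /cov nabla_mul; apply: eq_bigr => k _; congr (_ *: _).
by rewrite dmx_cst add0r.
Qed.

Lemma cov_cov_cst (v w z : 'cV[R]_n) y : D y ->
  cov h (cst w) (cov h (cst v) (cst z)) y =
  \sum_j \sum_k (w j 0 * v k 0) *: ((dmx j (Gam k) y + Gam j y *m Gam k y) *m z).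
Proof.
move=> Dy; rewrite {1}/cov nabla_mul; apply: eq_bigr => j _.
have E : cov h (cst v) (cst z) = fun y => (\sum_k v k 0 *: Gam k y) *m z.
  apply/funext => y'; rewrite cov_cst mulmx_suml; apply: eq_bigr => k _.
  by rewrite scalemxAl.
have CG : mx_C1 D (fun y => \sum_k v k 0 *: Gam k y).
  move=> a b; under eq_fun do rewrite summxE.
  apply: (class_C1_sum _ _ Do) => k; under eq_fun do rewrite mxE.
  exact: (class_C1M Do (class_C1_cst _ Do) (Gam_C1 k a b)).
rewrite E (dmxM Do j CG (mx_C1_cst Do z) Dy) dmx_cst mulmx0 addr0.
have -> : dmx j (fun y => \sum_k v k 0 *: Gam k y) y = \sum_k v k 0 *: dmx j (Gam k) y.
  apply/matrixP => a b; rewrite mxE summxE; under [in LHS]eq_fun do rewrite summxE.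
  have dk (k : 'I_n) : derivable (fun y => (v k 0 *: Gam k y) a b) y (e_ j).
    suff C : class_C 1 D (fun y => (v k 0 *: Gam k y) a b) by exact: class_C1_derivable C Dy.
    under eq_fun do rewrite mxE.
    exact: (class_C1M Do (class_C1_cst _ Do) (Gam_C1 k a b)).
  rewrite (partial_sum _ _ dk).2; apply: eq_bigr => k _; rewrite !mxE.
  under [in LHS]eq_fun do rewrite mxE.
  have dG := class_C1_derivable (j:=j) (Gam_C1 k a b) Dy.
  by rewrite (partialM (@derivable_const R n (v k 0) y (e_ j)) dG) partial_cst mul0r add0r.
rewrite mulmxA mulmx_sumr -mulmxDl -big_split /= mulmx_suml scaler_sumr.
apply: eq_bigr => k _; rewrite -scalemxAr -scalerDr -scalemxAl scalerA.
by [].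
Qed.

Lemma lie_bracket_cst (v w : 'cV[R]_n) y : lie_bracket (cst v) (cst w) y = 0.
Proof.
apply/colP => k; rewrite !mxE big1// => j _.
by rewrite !partial_cst !mulr0 subrr.
Qed.

Lemma riemann_curvatureE y (v w z : 'cV[R]_n) : D y ->
  riemann_curvature h y v w z =
  \sum_j \sum_k (w j 0 * v k 0) *: (curv j k y *m z).
Proof.
move=> Dy; rewrite /riemann_curvature /curvature_field.
rewrite [X in _ + X = _]/cov lie_bracket_cst mulmx0 addr0 !cov_cov_cst//.
rewrite [X in _ - X]exchange_big /=.
rewrite -sumrB; apply: eq_bigr => j _; rewrite -sumrB; apply: eq_bigr => k _.
by rewrite [v k 0 * _]mulrC -scalerBr -mulmxBl.
Qed.

End Geometry.

Lemma sum_regroup (V : zmodType) (a b c d e f : V) :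
  a + (b + c) + (d + e - f) = a + (c + d) - f + (b + e).
Proof. by rewrite !addrA [RHS](GRing.add.[ACl (1*5*2*3*6*4)]). Qed.

Lemma col_mulmx (F : pzSemiRingType) m n p (j : 'I_p) (A : 'M[F]_(m, n)) (B : 'M[F]_(n, p)) :
  col j (A *m B) = A *m col j B.
Proof. by apply/colP => i; rewrite !mxE; apply: eq_bigr => k _; rewrite mxE. Qed.

(** * The divergence identity for fields of class C^2 *)

Section SmoothIdentity.
Variables (R : realType) (n : nat) (D : set 'rV[R]_n) (h : 'rV[R]_n -> 'M[R]_n).
Hypotheses (Do : open D) (h_sym : forall y, D y -> (h y)^T = h y)
  (h_unit : forall y, D y -> h y \in unitmx)
  (h_C2 : forall a b, class_C 2 D (fun y => h y a b)).

(** The recursion of [J_] with a free matrix and polynomial Newton tensors, so that it applies to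
    fields whose covariant derivative has no real spectrum. *)
Fixpoint J_poly (y : 'rV[R]_n) (A : 'M[R]_n) s (v w : 'cV[R]_n) : R :=
  if s is s'.+1 then
    map_trace (fun z => newton_poly s' A *m riemann_curvature h y v z w)
    - J_poly y A s' (A *m v) w
  else 0.

(** The covariant derivative of an endomorphism field: the connection acts by the commutator. *)
Definition nabla_end (j : 'I_n) (B : 'rV[R]_n -> 'M[R]_n) y : 'M[R]_n :=
  dmx j B y + (Gam h j y *m B y - B y *m Gam h j y).

Section Field.
Variable X : 'rV[R]_n -> 'cV[R]_n.

Lemma nabla_C1 : (forall k, class_C 2 D (fun y => X y k 0)) ->
  mx_C1 D (nabla h X).
Proof.
move=> X_C2 k j; under eq_fun do rewrite mxE.
have [_ /(_ j)[_ d1]] := X_C2 k.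
apply: (class_C1D Do d1); apply: (class_C1_sum _ _ Do) => i.
apply: (class_C1M Do); last exact: class_CS (X_C2 i).
by have := Gam_C1 Do h_unit h_C2 j k i; under eq_fun do rewrite mxE.
Qed.

Hypothesis X_C2 : forall k, class_C 2 D (fun y => X y k 0).

Lemma X_C1 : mx_C1 D X.
Proof. by move=> a b; rewrite ord1; exact: class_CS (X_C2 a). Qed.

Lemma dmx_X_C1 k : mx_C1 D (dmx k X).
Proof.
move=> a b; under eq_fun do rewrite mxE.
by rewrite ord1; have [_ /(_ k)[]] := X_C2 a.
Qed.

Let A := nabla h X.
Let A_C1 : mx_C1 D A := nabla_C1 X_C2.

Lemma dmxC j k y : D y -> dmx j (dmx k X) y = dmx k (dmx j X) y.
Proof.
move=> Dy; apply/matrixP => a b; rewrite ord1.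
have E i k' : dmx i (dmx k' X) y a 0 = partial i (partial k' (fun z => X z a 0)) y.
  rewrite mxE; apply: (eq_partial Do _ Dy) => z _.
  by rewrite mxE.
have /nbhs_ballP[r /= r0 rD] : nbhs y D by exact: open_nbhs_nbhs.
have Ca := class_C_subset rD (X_C2 a).
exact: etrans (E j k) (etrans (partialC j k r0 Ca) (esym (E k j))).
Qed.

(** In the expansion of (nabla_j A) e_k the second derivatives of [X], the terms Gam * dX and the
    torsion-free term A Gam_j e_k are symmetric in j and k. Only the terms that make up [curv]
    survive the difference. *)
Lemma ricci_identity j k y : D y ->
  col k (nabla_end j A y) - col j (nabla_end k A y) = curv h j k y *m X y.
Proof.
move=> Dy.
have E j' k' : col k' (nabla_end j' A y) =
  dmx j' (dmx k' X) y + (Gam h k' y *m dmx j' X y + Gam h j' y *m dmx k' X y)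
  - A y *m col k' (Gam h j' y)
  + (dmx j' (Gam h k') y + Gam h j' y *m Gam h k' y) *m X y.
  have CG := Gam_C1 Do h_unit h_C2 k'.
  rewrite /nabla_end !raddfD raddfN /= !col_mulmx.
  have -> : col k' (dmx j' A y) = dmx j' (fun y => dmx k' X y + Gam h k' y *m X y) y.
    apply/matrixP => a b; rewrite !mxE; apply: (eq_partial Do _ Dy) => z _.
    by rewrite -nablaE [RHS]mxE.
  rewrite (dmxD j' (dmx_X_C1 k') (mx_C1M Do CG X_C1) Dy) (dmxM Do j' CG X_C1 Dy).
  rewrite nablaE mulmxDr mulmxDl mulmxA.
  exact: sum_regroup.
rewrite (E j k) (E k j) (dmxC j k Dy) (addrC (Gam h k y *m dmx j X y)).
have -> : col j (Gam h k y) = col k (Gam h j y).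
  by apply/matrixP => a b; rewrite !mxE; exact: (christoffel_sym Do h_sym).
by rewrite opprD addrACA subrr add0r -mulmxBl.
Qed.

(** By [dfaddeev_comm] the commutator with [Gam] does not change [sigma], and on [newton_poly] it
    supplies exactly the connection terms of the covariant derivative. *)
Lemma partial_sigma_nabla r k y : D y ->
  dsigma r (A y) (nabla_end k A y) = partial k (fun y => sigma r (A y)) y /\
  dnewton r (A y) (nabla_end k A y) = nabla_end k (fun y => newton_poly r (A y)) y.
Proof.
move=> Dy; have [-> ->] := dfaddeevD (A y) (dmx k A y) (Gam h k y *m A y - A y *m Gam h k y) r.
have [-> ->] := dfaddeev_comm (A y) (Gam h k y) r.
by have [-> E] := partial_newton_poly Do r k A_C1 Dy; rewrite addr0 /nabla_end E.
Qed.

Definition div_end r y (v : 'cV[R]_n) : R :=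
  \sum_k (dnewton r (A y) (nabla_end k A y) *m v) k 0.

Lemma div_newton_J r y v : D y -> div_end r y v = - J_poly y (A y) r v (X y).
Proof.
move=> Dy; elim: r v => [|r IH] v.
  by rewrite oppr0 /div_end big1// => k _; rewrite /dnewton /= mul0mx mxE.
rewrite /= opprB -[J_poly _ _ _ _ _]opprK -IH /map_trace /mxtrace.
(* In the trace, R(v, e_j) X is replaced by (nabla_j A) v - (nabla_v A) e_j. Summed over j, the
   second part becomes tr (P_r nabla_v A) = dS_(r+1) (v). *)
under [in RHS]eq_bigr => j _.
  rewrite mxE (riemann_curvatureE Do h_unit h_C2 _ _ _ Dy).
  rewrite (_ : \sum_(_ < n) _ = nabla_end j A y *m v
    - \sum_k v k 0 *: col j (nabla_end k A y)); last first.
    rewrite (bigD1 j) //= [X in _ + X]big1 ?addr0 => [|j' jj']; last first.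
      by rewrite big1// => k _; rewrite mxE (negbTE jj') /= mul0r scale0r.
    under eq_bigr do rewrite mxE !eqxx mul1r -ricci_identity// scalerBr.
    rewrite sumrB; congr (_ - _).
    apply/colP => a; rewrite summxE mxE; apply: eq_bigr => k _.
    by rewrite !mxE mulrC.
  rewrite mulmxBr mulmx_sumr mxE [X in _ + X]mxE summxE.
  under [X in _ - X]eq_bigr do rewrite -scalemxAr mxE.
  over.
rewrite sumrB exchange_big /= /div_end.
(* Commuting [A] past dP_r places it next to [v], so the induction hypothesis is used at the vector
   A v. *)
have E k : dnewton r.+1 (A y) (nabla_end k A y) *m v =
  (\tr (newton_poly r (A y) *m nabla_end k A y)) *: v
  - dnewton r (A y) (nabla_end k A y) *m (A y *m v)
  - newton_poly r (A y) *m (nabla_end k A y *m v).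
  rewrite dnewtonS dsigma_trace dnewton_comm mulmxBl mulmxDl mul_scalar_mx !mulmxA.
  by rewrite opprD addrA.
rewrite -sumrN -!sumrB; apply: eq_bigr => k _; rewrite E.
have -> : \sum_i v k 0 * (newton_poly r (A y) *m col i (nabla_end k A y)) i 0 =
    v k 0 * \tr (newton_poly r (A y) *m nabla_end k A y).
  by rewrite -mulr_sumr; congr (_ * _); apply: eq_bigr => i _; rewrite -col_mulmx mxE.
set B := dnewton _ _ _ *m _; set C := newton_poly _ _ *m (_ *m v).
by rewrite 2!mxE [(_ *: v) k 0]mxE [(- B) k 0]mxE [(- C) k 0]mxE; ring.
Qed.

Lemma div_newton r y : D y ->
  div_g h (fun y => newton_poly r (A y) *m X y) y =
  r.+1%:R * sigma r.+1 (A y) - J_poly y (A y) r (X y) (X y).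
Proof.
move=> Dy; have [_ CN] := newton_poly_C1 Do r A_C1.
rewrite -div_newton_J// sigmaS mulrC divfK ?pnatr_eq0// newton_poly_comm.
rewrite /div_g /mxtrace /div_end -big_split /=; apply: eq_bigr => k _.
have [_ ->] := partial_sigma_nabla r k Dy.
set N := fun y => newton_poly r (A y).
have -> : nabla h (fun y => N y *m X y) y k k = (col k (nabla h (fun y => N y *m X y) y)) k 0.
  by rewrite [RHS]mxE.
have -> : (newton_poly r (A y) *m A y) k k = (N y *m col k (A y)) k 0.
  by rewrite -col_mulmx [RHS]mxE.
rewrite nablaE nablaE (dmxM Do k CN X_C1 Dy).
have addk (U W : 'cV[R]_n) : U k 0 + W k 0 = (U + W) k 0 by rewrite mxE.
rewrite addk.
(* The term t = P_r Gam_k X is added and subtracted: one copy completes nabla X, the other the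
   commutator in nabla P_r. *)
have regroup (V : zmodType) (p q u t : V) : p + q + u = q + t + (p + (u - t)).
  by rewrite -addrA [RHS]addrCA -[q + t + _]addrA [t + _]addrC subrK.
rewrite /nabla_end [in RHS]mulmxDr 2![in RHS]mulmxDl [in RHS]mulNmx !mulmxA.
congr ((_ : 'cV_n) k 0).
exact: regroup.
Qed.

End Field.
End SmoothIdentity.

(** * The shape operator of a graph *)

Lemma posdef_unitmx (F : numFieldType) n (G : 'M[F]_n) :
  (forall v : 'rV_n, v != 0 -> 0 < (v *m G *m v^T) 0 0) -> G \in unitmx.
Proof.
move=> Gp; rewrite -row_free_unit -kermx_eq0; apply/eqP/row_matrixP => i.
apply/eqP; rewrite row0; apply: contraTT isT => /Gp.
have -> : row i (kermx G) *m G = 0 by rewrite -row_mul mulmx_ker row0.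
by rewrite mul0mx mxE ltxx.
Qed.

(** [eigenvalues] is a choice. Any splitting [d] certifies that the chosen tuple splits the
    characteristic polynomial too, and [sigma] does not depend on which splitting it is. *)
Lemma char_poly_sigma (R : realType) n (B : 'M[R]_n) (d : 'I_n -> R) r :
  (0 < n)%N -> (r <= n)%N -> char_poly B = \prod_i ('X - (d i)%:P) ->
  S_ r B = sigma r B.
Proof.
move=> n0 rn HB; rewrite /S_ /elementary_symmetric.
have : char_poly B = \prod_i ('X - (eigenvalues B 0 i)%:P).
  apply: (@xgetPex _ 0 [set k : 'rV[R]_n | char_poly B = \prod_i ('X - (k 0 i)%:P)]).
  by exists (\row_i d i); rewrite /= HB; apply: eq_bigr => i _; rewrite mxE.
by move=> /(sigma_split n0 rn) ->.
Qed.

Lemma newton_newton_poly (R : realType) n (B : 'M[R]_n) (d : 'I_n -> R) r :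
  (0 < n)%N -> (r <= n)%N -> char_poly B = \prod_i ('X - (d i)%:P) ->
  newton r B = newton_poly r B.
Proof.
move=> n0 rn HB; elim: r rn => [//|r IH] rn.
by rewrite newton_polyS /= (char_poly_sigma n0 rn HB) IH// ltnW.
Qed.

Lemma trmx11 (F : nmodType) (M : 'M[F]_1) : M^T = M.
Proof. by apply/matrixP => a b; rewrite mxE !ord1. Qed.

Lemma dot_sym (F : comPzSemiRingType) n (v w : 'cV[F]_n) : v^T *m w = w^T *m v.
Proof. by rewrite -[LHS]trmx11 trmx_mul trmxK. Qed.

Lemma quad_antisym (F : numFieldType) n (v : 'cV[F]_n) (K : 'M[F]_n) :
  K^T = - K -> v^T *m K *m v = 0.
Proof.
move=> KT; have E : v^T *m K *m v = - (v^T *m K *m v).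
  by rewrite -{1}mulmxA dot_sym trmx_mul KT mulmxN mulNmx.
apply/matrixP => a b; rewrite [RHS]mxE; apply/eqP.
by rewrite -[_ == 0](mulrn_eq0 _ 2) mulr2n {1}E mxE addNr.
Qed.

Section ShapeOperator.
Variables (R : realType) (n : nat) (D : set 'rV[R]_n).
Variables (h : 'rV[R]_n -> 'M[R]_n) (u : 'rV[R]_n -> R).
Hypotheses (Do : open D) (h_sym : forall y, D y -> (h y)^T = h y)
  (h_pos : forall y, D y -> forall v : 'rV_n, v != 0 -> 0 < (v *m h y *m v^T) 0 0)
  (h_C2 : forall a b, class_C 2 D (fun y => h y a b))
  (u_C2 : class_C 2 D u).

Let h_unit y : D y -> h y \in unitmx.
Proof. by move=> Dy; apply: posdef_unitmx; exact: h_pos. Qed.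

Let U := grad_g h u.
Let du y : 'cV[R]_n := \col_i partial i u y.
Let q y : R := ((U y)^T *m h y *m U y) 0 0.

Lemma h_grad y : D y -> h y *m U y = du y.
Proof. by move=> Dy; rewrite /U /grad_g mulKVmx//; exact: h_unit. Qed.

Lemma du_C1 : mx_C1 D du.
Proof.
move=> a b; under eq_fun do rewrite mxE.
by have [_ /(_ a)[]] := u_C2.
Qed.

Lemma grad_C1 : mx_C1 D U.
Proof. exact: (mx_C1M Do (mx_C1_invmx Do h_unit (h_C1 h_C2)) du_C1). Qed.

Lemma q_ge0 y : D y -> 0 <= q y.
Proof.
move=> Dy; have [U0|U0] := eqVneq ((U y)^T) 0; first by rewrite /q U0 !mul0mx mxE.
by have := h_pos Dy U0; rewrite trmxK; apply: ltW.
Qed.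

Lemma qE y : D y -> q y = ((du y)^T *m U y) 0 0.
Proof.
by move=> Dy; rewrite /q -(h_grad Dy) (trmx_mul (h y)) (h_sym Dy).
Qed.

Lemma q_C1 : class_C 1 D q.
Proof.
have CT : mx_C1 D (fun y => (U y)^T).
  by move=> a b; under eq_fun do rewrite mxE; exact: grad_C1.
exact: (mx_C1M Do (mx_C1M Do CT (h_C1 h_C2)) grad_C1 0 0).
Qed.

Let w y := (Num.sqrt (1 + q y))^-1.

Lemma q1_gt0 y : D y -> 0 < 1 + q y.
Proof. by move=> Dy; rewrite ltr_wpDr// q_ge0. Qed.

Lemma w_C1 : class_C 1 D w.
Proof.
apply: (class_C1V Do).
  by move=> y Dy; rewrite gt_eqF// sqrtr_gt0 q1_gt0.
apply: (class_C1_sqrt Do); first exact: q1_gt0.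
exact: (class_C1D Do (class_C1_cst _ Do) q_C1).
Qed.

(** Differentiating this polynomial relation and dividing by 2w gives the derivative of w = 1 / W
    without differentiating a square root. *)
Lemma w2 y : D y -> w y * w y * (1 + q y) = 1.
Proof.
move=> Dy; have q1 := q1_gt0 Dy.
rewrite /w -{3}(sqr_sqrtr (ltW q1)) expr2.
have s0 : Num.sqrt (1 + q y) != 0 by rewrite gt_eqF// sqrtr_gt0.
by rewrite mulrACA mulVf// mulr1.
Qed.

Lemma slantE y : D y -> (slant h u y)^-1 = w y.
Proof.
move=> Dy; rewrite /slant /norm_g sqr_sqrtr//.
exact: q_ge0.
Qed.

Lemma grad_over_WE y : D y -> grad_over_W h u y = U y *m (w y)%:M.
Proof. by move=> Dy; rewrite /grad_over_W slantE// mul_mx_scalar. Qed.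

Lemma grad_over_W_C1 : mx_C1 D (grad_over_W h u).
Proof.
apply: (mx_C1_eq Do (B := fun y => U y *m (w y)%:M)).
  by move=> y /grad_over_WE ->.
exact: (mx_C1M Do grad_C1 (mx_C1_scalar Do w_C1)).
Qed.

Lemma h_Gam j l i y : D y -> (h y *m Gam h j y) l i =
  2^-1 * (partial j (fun z => h z i l) y + partial i (fun z => h z j l) y
          - partial l (fun z => h z j i) y).
Proof.
move=> Dy; pose T : 'cV[R]_n := \col_m (partial j (fun z => h z i m) y
  + partial i (fun z => h z j m) y - partial m (fun z => h z j i) y).
have -> : (h y *m Gam h j y) l i = 2^-1 * (h y *m (invmx (h y) *m T)) l 0.
  rewrite [LHS]mxE [X in _ = _ * X]mxE mulr_sumr; apply: eq_bigr => k _.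
  rewrite [Gam _ _ _ _ _]mxE /christoffel [LHS]mulrCA; congr (_ * (_ * _)).
  by rewrite [RHS]mxE; apply: eq_bigr => m _; rewrite [T _ _]mxE.
by rewrite mulKVmx ?h_unit// mxE.
Qed.

(** Column j of the covariant Hessian of [u]: the derivative of the gradient, with its index lowered
    by the metric. *)
Let Hs j y : 'cV[R]_n := h y *m (dmx j U y + Gam h j y *m U y).

Lemma partial_h_sym i j l y : D y ->
  partial i (fun z => h z j l) y = partial i (fun z => h z l j) y.
Proof. by move=> Dy; apply: (eq_partial Do _ Dy) => z Dz; rewrite -{1}(h_sym Dz) mxE. Qed.

Lemma h_dU j y : D y -> h y *m dmx j U y = dmx j du y - dmx j h y *m U y.
Proof.
move=> Dy.
have <- : dmx j (fun z => h z *m U z) y = dmx j du y.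
  by apply: (eq_dmx Do _ Dy) => z; exact: h_grad.
by rewrite (dmxM Do j (h_C1 h_C2) grad_C1 Dy) addrAC subrr add0r.
Qed.

Lemma HsE j l y : D y -> Hs j y l 0 = partial j (partial l u) y +
  2^-1 * \sum_i (partial i (fun z => h z j l) y - partial j (fun z => h z i l) y
                 - partial l (fun z => h z j i) y) * U y i 0.
Proof.
move=> Dy; rewrite /Hs mulmxDr (h_dU j Dy) mulmxA.
have -> : dmx j du y - dmx j h y *m U y + h y *m Gam h j y *m U y
  = dmx j du y + (h y *m Gam h j y - dmx j h y) *m U y.
  by rewrite mulmxBl [RHS]addrA [LHS]addrAC.
rewrite mxE; congr (_ + _).
  by rewrite mxE; apply: (eq_partial Do _ Dy) => z _; rewrite mxE.
rewrite mxE mulr_sumr; apply: eq_bigr => i _; rewrite mulrA; congr (_ * _).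
rewrite mxE h_Gam// [X in _ + X]mxE [dmx j h y l i]mxE (partial_h_sym j l i Dy).
by field.
Qed.

Lemma Hs_sym j l y : D y -> Hs j y l 0 = Hs l y j 0.
Proof.
move=> Dy; refine (etrans (HsE j l Dy) (etrans _ (esym (HsE l j Dy)))).
refine (f_equal2 +%R _ (f_equal ( *%R 2^-1) _)).
  have /nbhs_ballP[r /= r0 rD] : nbhs y D by exact: open_nbhs_nbhs.
  exact: (partialC j l r0 (class_C_subset rD u_C2)).
apply: eq_bigr => i _; congr (_ * _).
rewrite (partial_h_sym i j l Dy) (partial_h_sym j i l Dy) (partial_h_sym l j i Dy).
by rewrite addrAC.
Qed.

(** For fixed j the lowered connection matrix is half the derivative of the metric plus an
    antisymmetric matrix, which a quadratic form does not see. *)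
Lemma h_Gam_quad j y : D y ->
  (U y)^T *m (h y *m Gam h j y) *m U y = 2^-1 *: ((U y)^T *m dmx j h y *m U y).
Proof.
move=> Dy; pose K : 'M[R]_n := \matrix_(l, i)
  (partial i (fun z => h z j l) y - partial l (fun z => h z j i) y).
have EK : h y *m Gam h j y = 2^-1 *: (dmx j h y + K).
  apply/matrixP => l i; rewrite (h_Gam j l i Dy) [RHS]mxE [X in _ = _ * X]mxE.
  rewrite [K l i]mxE [dmx j h y l i]mxE (partial_h_sym j l i Dy).
  by rewrite -addrA.
have K0 : (U y)^T *m K *m U y = 0.
  by apply: quad_antisym; apply/matrixP => l i; rewrite !mxE opprB.
by rewrite EK -scalemxAr -scalemxAl mulmxDr mulmxDl K0 addr0.
Qed.

(** Metric compatibility of the connection, for the squared norm of the gradient. *)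
Lemma partial_q j y : D y -> partial j q y = 2 * ((U y)^T *m Hs j y) 0 0.
Proof.
move=> Dy.
have CT : mx_C1 D (fun y => (du y)^T).
  by move=> a b; under eq_fun do rewrite mxE; exact: du_C1.
have -> : partial j q y = dmx j (fun z => (du z)^T *m U z) y 0 0.
  by rewrite mxE; apply: (eq_partial Do _ Dy) => z; exact: qE.
rewrite (dmxM Do j CT grad_C1 Dy).
have -> : dmx j (fun z => (du z)^T) y = (dmx j du y)^T.
  by apply/matrixP => a b; rewrite !mxE; apply: (eq_partial Do _ Dy) => z _; rewrite mxE.
have -> : (dmx j du y)^T *m U y = (U y)^T *m dmx j du y.
  exact: dot_sym.
have -> : (du y)^T *m dmx j U y = (U y)^T *m (dmx j du y - dmx j h y *m U y).
  by rewrite -(h_dU j Dy) -(h_grad Dy) (trmx_mul (h y)) (h_sym Dy) mulmxA.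
rewrite /Hs [h y *m (_ + _)]mulmxDr (h_dU j Dy) [(U y)^T *m (_ + h y *m _)]mulmxDr.
rewrite [h y *m (_ *m _)]mulmxA [(U y)^T *m (_ *m U y)]mulmxA (h_Gam_quad j Dy).
rewrite mulmxBr [(U y)^T *m (dmx j h y *m _)]mulmxA.
set a := (U y)^T *m dmx j du y; set b := _ *m dmx j h y *m _.
by rewrite ![in LHS]mxE ![in RHS]mxE; field.
Qed.

Let A := nabla h (grad_over_W h u).

(** The induced metric times the shape operator is the second fundamental form Hess u / W. Since
    nabla_j X = w C + (d_j w) U, the left side is w Hs_j plus a multiple of du with coefficient d_j
    w (1 + q) + w <U, Hs_j>, which is zero. *)
Lemma metric_shape_col j y : D y ->
  (h y + du y *m (du y)^T) *m col j (A y) = w y *: Hs j y.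
Proof.
move=> Dy; rewrite nablaE.
have -> : dmx j (grad_over_W h u) y = w y *: dmx j U y + partial j w y *: U y.
  have -> : dmx j (grad_over_W h u) y = dmx j (fun z => U z *m (w z)%:M) y.
    by apply: (eq_dmx Do _ Dy) => z; exact: grad_over_WE.
  rewrite (dmxM Do j grad_C1 (mx_C1_scalar Do w_C1) Dy) dmx_scalar.
  by rewrite !mul_mx_scalar.
rewrite (grad_over_WE Dy) mul_mx_scalar -scalemxAr addrAC -scalerDr.
set C := dmx j U y + _.
have HC : h y *m C = Hs j y by [].
have dwE : partial j w y * (1 + q y) + w y * ((U y)^T *m Hs j y) 0 0 = 0.
  have dw := class_C1_derivable (j:=j) w_C1 Dy.
  have dq := class_C1_derivable (j:=j) (class_C1D Do (class_C1_cst 1 Do) q_C1) Dy.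
  have dww := class_C1_derivable (j:=j) (class_C1M Do w_C1 w_C1) Dy.
  have : partial j (fun z => w z * w z * (1 + q z)) y = 0.
    rewrite -(partial_cst j 1 y); apply: (eq_partial Do _ Dy) => z; exact: w2.
  rewrite (partialM dww dq) (partialM dw dw).
  have -> : partial j (fun z => 1 + q z) y = partial j q y.
    rewrite (partialD (@derivable_const R n 1 y (e_ j)) (class_C1_derivable q_C1 Dy)).
    by rewrite partial_cst add0r.
  rewrite (partial_q j Dy) => E.
  have w0 : w y != 0 by rewrite invr_eq0 gt_eqF// sqrtr_gt0 q1_gt0.
  apply: (mulfI w0); rewrite mulr0.
  move: E; move: (partial j w y) (w y) (q y) (_ 0 0) => a b c d E; lra.
have UC : (du y)^T *m C = (U y)^T *m Hs j y.
  by rewrite -(h_grad Dy) (trmx_mul (h y)) (h_sym Dy) -HC mulmxA.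
have Uq : (du y)^T *m U y = (q y)%:M.
  by apply/matrixP => a b; rewrite !ord1 -(qE Dy) mxE eqxx mulr1n.
rewrite mulmxDl mulmxDr -!scalemxAr HC (h_grad Dy) -mulmxA mulmxDr -!scalemxAr UC Uq.
rewrite [(U y)^T *m Hs j y]mx11_scalar !scale_scalar_mx -raddfD /= mul_mx_scalar.
have E0 : partial j w y +
    (w y * ((U y)^T *m Hs j y) 0 0 + partial j w y * q y) = 0.
  by rewrite -[RHS]dwE mulrDr mulr1 -addrA [X in _ + X = _]addrC.
by rewrite -addrA -scalerDl E0 scale0r addr0.
Qed.

Lemma shape_operator_split y : D y ->
  exists d : 'I_n -> R, char_poly (shape_operator h u y) = \prod_i ('X - (d i)%:P).
Proof.
move=> Dy; apply: (@selfadjoint_split R n (h y + du y *m (du y)^T) (A y)).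
- by rewrite raddfD /= trmx_mul trmxK (h_sym Dy).
- move=> v v0; rewrite mulmxDr mulmxDl mxE ltr_pwDl ?h_pos//.
  have -> : v *m (du y *m (du y)^T) *m v^T = (v *m du y) *m (v *m du y)^T.
    by rewrite trmx_mul !mulmxA.
  by rewrite mxE big_ord1 [_^T _ _]mxE -expr2 sqr_ge0.
- have E l j : ((h y + du y *m (du y)^T) *m A y) l j = w y * Hs j y l 0.
    have := congr1 (fun M : 'cV[R]_n => M l 0) (metric_shape_col j Dy).
    by rewrite /= -col_mulmx mxE => ->; rewrite mxE.
  apply/matrixP => l j; rewrite [LHS]mxE !E; congr (_ * _).
  exact: Hs_sym.
Qed.

End ShapeOperator.

(** * Passage to the limit *)

Section UniformLimits.
Variables (R : realType) (T : Type) (B : set T).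
Implicit Types f g : T -> R.

(** Boundedness of the limit is part of the notion because uniform convergence alone does not pass
    to products. *)
Definition ucvg (fs : nat -> T -> R) f :=
  (exists K : R, forall y, B y -> `|f y| <= K) /\
  (forall eta : R, 0 < eta -> exists N, forall m, (N <= m)%N ->
     forall y, B y -> `|fs m y - f y| <= eta).

Lemma ucvg_eq (fs : nat -> T -> R) f (gs : nat -> T -> R) g :
  (forall m y, B y -> fs m y = gs m y) ->
  (forall y, B y -> f y = g y) -> ucvg fs f -> ucvg gs g.
Proof.
move=> fgs fg [[K HK] H]; split; first by exists K => y By; rewrite -fg// HK.
move=> eta eta0; have [N HN] := H eta eta0; exists N => m Nm y By.
by rewrite -fgs// -fg// HN.
Qed.

Lemma ucvg_cst f (K : R) : (forall y, B y -> `|f y| <= K) -> ucvg (fun=> f) f.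
Proof.
move=> HK; split; first by exists K.
by move=> eta eta0; exists 0%N => m _ y By; rewrite subrr normr0 ltW.
Qed.

Lemma ucvgD fs f gs g : ucvg fs f -> ucvg gs g ->
  ucvg (fun m y => fs m y + gs m y) (fun y => f y + g y).
Proof.
move=> [[K HK] Hf] [[L HL] Hg]; split.
  exists (K + L) => y By; apply: le_trans (ler_normD _ _) _.
  by apply: lerD; [exact: HK|exact: HL].
move=> eta eta0; have e2 : 0 < eta / 2 by rewrite divr_gt0.
have [N HN] := Hf _ e2; have [N' HN'] := Hg _ e2.
exists (maxn N N') => m; rewrite geq_max => /andP[Nm N'm] y By.
rewrite opprD addrACA; apply: le_trans (ler_normD _ _) _.
by rewrite [leRHS]splitr; apply: lerD; [exact: HN|exact: HN'].
Qed.

Lemma ucvgM fs f gs g : ucvg fs f -> ucvg gs g ->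
  ucvg (fun m y => fs m y * gs m y) (fun y => f y * g y).
Proof.
move=> [[K HK] Hf] [[L HL] Hg]; split.
  exists (K * L) => y By; rewrite normrM.
  by apply: ler_pM => //; [exact: HK|exact: HL].
move=> eta eta0.
(* The summand 1 bounds the approximants of [g] as well, since the tolerance [d] is at most 1. *)
pose C := `|K| + `|L| + 1.
have C0 : 0 < C by rewrite ltr_wpDl// addr_ge0.
pose d := Num.min 1 (eta / (2 * C)).
have d0 : 0 < d by rewrite lt_min ltr01 divr_gt0// mulr_gt0.
have [N HN] := Hf _ d0; have [N' HN'] := Hg _ d0.
exists (maxn N N') => m; rewrite geq_max => /andP[Nm N'm] y By.
have hf := HN m Nm y By; have hg := HN' m N'm y By.
have fK : `|f y| <= C.
  apply: le_trans (HK y By) _; apply: le_trans (ler_norm _) _.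
  by rewrite /C -addrA lerDl addr_ge0.
have gK : `|gs m y| <= C.
  rewrite -[gs m y](subrK (g y)); apply: le_trans (ler_normD _ _) _.
  rewrite /C addrC; apply: lerD.
    apply: le_trans (HL y By) _; apply: le_trans (ler_norm _) _.
    by rewrite lerDr.
  by apply: le_trans hg _; rewrite ge_min lexx.
have -> : fs m y * gs m y - f y * g y =
    (fs m y - f y) * gs m y + f y * (gs m y - g y) by ring.
apply: le_trans (ler_normD _ _) _; rewrite !normrM.
have dC : d * C <= eta / 2.
  have : d <= eta / (2 * C) by rewrite ge_min lexx orbT.
  by rewrite ler_pdivlMr ?mulr_gt0// mulrCA mulrC => ?; rewrite ler_pdivlMr.
rewrite [leRHS]splitr; apply: lerD; apply: le_trans dC.
  by apply: ler_pM.
by rewrite mulrC; apply: ler_pM.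
Qed.

Lemma ucvgN fs f : ucvg fs f -> ucvg (fun m y => - fs m y) (fun y => - f y).
Proof.
move=> [[K HK] Hf]; split; first by exists K => y By; rewrite normrN; exact: HK.
move=> eta eta0; have [N HN] := Hf _ eta0; exists N => m Nm y By.
by rewrite -opprD normrN; exact: HN.
Qed.

Lemma ucvg_const (a : R) : ucvg (fun _ _ => a) (fun=> a).
Proof. by apply: (@ucvg_cst (fun=> a) `|a|). Qed.

Lemma ucvg_sum (I : Type) (s : seq I) (Fs : I -> nat -> T -> R) (F : I -> T -> R) :
  (forall i, ucvg (Fs i) (F i)) ->
  ucvg (fun m y => \sum_(i <- s) Fs i m y) (fun y => \sum_(i <- s) F i y).
Proof.
move=> H; elim: s => [|i s IH].
  by apply: ucvg_eq (ucvg_const 0) => *; rewrite big_nil.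
by apply: ucvg_eq (ucvgD (H i) IH) => *; rewrite big_cons.
Qed.

Definition mx_ucvg p q (Ms : nat -> T -> 'M[R]_(p, q)) (M : T -> 'M[R]_(p, q)) :=
  forall a b, ucvg (fun m y => Ms m y a b) (fun y => M y a b).

Lemma mx_ucvgM p q s (Ms : nat -> T -> 'M[R]_(p, q)) M (Ns : nat -> T -> 'M[R]_(q, s)) N :
  mx_ucvg Ms M -> mx_ucvg Ns N ->
  mx_ucvg (fun m y => Ms m y *m Ns m y) (fun y => M y *m N y).
Proof.
move=> HM HN a b; apply: ucvg_eq (ucvg_sum _ (fun k => ucvgM (HM a k) (HN k b))) => *;
by rewrite mxE.
Qed.

Lemma mx_ucvgD p q (Ms Ns : nat -> T -> 'M[R]_(p, q)) M N :
  mx_ucvg Ms M -> mx_ucvg Ns N ->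
  mx_ucvg (fun m y => Ms m y + Ns m y) (fun y => M y + N y).
Proof. by move=> HM HN a b; apply: ucvg_eq (ucvgD (HM a b) (HN a b)) => *; rewrite mxE. Qed.

Lemma mx_ucvgN p q (Ms : nat -> T -> 'M[R]_(p, q)) M :
  mx_ucvg Ms M -> mx_ucvg (fun m y => - Ms m y) (fun y => - M y).
Proof. by move=> HM a b; apply: ucvg_eq (ucvgN (HM a b)) => *; rewrite mxE. Qed.

Lemma mx_ucvg_scalar p fs f : ucvg fs f ->
  mx_ucvg (fun m y => (fs m y)%:M : 'M[R]_p) (fun y => (f y)%:M).
Proof.
move=> Hf a b; case ab: (a == b).
  by apply: ucvg_eq Hf => *; rewrite mxE ab.
by apply: ucvg_eq (ucvg_const 0) => *; rewrite mxE ab.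
Qed.

Lemma ucvg_trace p (Ms : nat -> T -> 'M[R]_p) M : mx_ucvg Ms M ->
  ucvg (fun m y => \tr (Ms m y)) (fun y => \tr (M y)).
Proof. by move=> HM; exact: (ucvg_sum _ (fun k => HM k k)). Qed.

Lemma newton_poly_ucvg n (As : nat -> T -> 'M[R]_n) A r : mx_ucvg As A ->
  ucvg (fun m y => sigma r (As m y)) (fun y => sigma r (A y)) /\
  mx_ucvg (fun m y => newton_poly r (As m y)) (fun y => newton_poly r (A y)).
Proof.
move=> HA; elim: r => [|r [_ IH]].
  by split=> [|a b]; exact: ucvg_const.
have HAN := mx_ucvgM HA IH.
have HS : ucvg (fun m y => sigma r.+1 (As m y)) (fun y => sigma r.+1 (A y)).
  exact: (ucvgM (ucvg_trace HAN) (ucvg_const _)).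
split; first exact: HS.
have HSM : mx_ucvg (fun m y => (sigma r.+1 (As m y))%:M : 'M[R]_n)
    (fun y => (sigma r.+1 (A y))%:M) by exact: mx_ucvg_scalar.
move=> a b; have H := mx_ucvgD HSM (mx_ucvgN HAN) a b.
by apply: ucvg_eq H => *; rewrite newton_polyS.
Qed.

End UniformLimits.

Lemma ucvg_continuous (R : realType) n (x0 : 'rV[R]_n) (s : R) Fs F : 0 < s ->
  (forall m, class_C0 (ball x0 s) (Fs m)) -> ucvg (ball x0 s) Fs F ->
  {for x0, continuous F}.
Proof.
move=> s0 cF [_ H]; apply/(@cvgrPdist_le _ _ _ (nbhs x0)) => eta eta0.
have e3 : 0 < eta / 3 by rewrite divr_gt0.
have [N HN] := H _ e3; have bx : ball x0 s x0 by exact: ballxx.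
have /cvgrPdist_le/(_ _ e3) N1 := cF N x0 bx.
have N2 : nbhs x0 (ball x0 s) by exact: nbhsx_ballx.
apply: filterS (filterI N1 N2) => z [h1 zs].
have h2 := HN N (leqnn N) z zs; have h3 := HN N (leqnn N) x0 bx.
have -> : F x0 - F z = - (Fs N x0 - F x0) + (Fs N x0 - Fs N z) + (Fs N z - F z) by ring.
have -> : eta = eta / 3 + eta / 3 + eta / 3 by field.
apply: le_trans (ler_normD _ _) _; apply: lerD h2.
by apply: le_trans (ler_normD _ _) _; apply: lerD h1; rewrite normrN.
Qed.

Section LocalIdentity.
Variables (R : realType) (n : nat) (x0 : 'rV[R]_n) (r0 : R).
Variables (h : 'rV[R]_n -> 'M[R]_n).
Hypothesis r0_gt0 : 0 < r0.
Let D := ball x0 r0.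
(** On the half ball, functions continuous on [D] are bounded and the C^2 approximants are
    available. *)
Let B := ball x0 (r0 / 2).
Hypotheses (h_sym : forall y, D y -> (h y)^T = h y)
  (h_unit : forall y, D y -> h y \in unitmx)
  (h_C2 : forall a b, class_C 2 D (fun y => h y a b)).

Let Do : open D. Proof. exact: ball_open. Qed.
Let r0h : r0 / 2 < r0. Proof. by move: r0_gt0 => ?; lra. Qed.
Let BD y : B y -> D y. Proof. by apply: ball_le; exact: ltW. Qed.

Lemma ucvg_C0 f : class_C0 D f -> ucvg B (fun=> f) f.
Proof.
move=> cf; have [K [_ HK]] := unif_continuous_bounded r0h cf.
exact: ucvg_cst HK.
Qed.

Lemma Gam_C0 j a b : class_C0 D (fun y => Gam h j y a b).
Proof. by have /class_C1E[] := Gam_C1 Do h_unit h_C2 j a b. Qed.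

Lemma dGam_C0 i j a b : class_C0 D (fun y => dmx i (Gam h j) y a b).
Proof.
under eq_fun do rewrite mxE.
by have /class_C1E[_ /(_ i)[]] := Gam_C1 Do h_unit h_C2 j a b.
Qed.

(** The metric is not approximated; the content for these constant sequences is the boundedness of
    the curvature on [B]. *)
Lemma curv_ucvg j k : mx_ucvg B (fun=> curv h j k) (curv h j k).
Proof.
have HG i : mx_ucvg B (fun=> Gam h i) (Gam h i).
  by move=> a b; apply: ucvg_C0; exact: Gam_C0.
have Hd i i' : mx_ucvg B (fun=> dmx i (Gam h i')) (dmx i (Gam h i')).
  by move=> a b; apply: ucvg_C0; exact: dGam_C0.
have H i i' := mx_ucvgD (Hd i i') (mx_ucvgM (HG i) (HG i')).
exact: (mx_ucvgD (H j k) (mx_ucvgN (H k j))).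
Qed.

Lemma riemann_ucvg (z : 'cV[R]_n) vs v ws w :
  mx_ucvg B vs v -> mx_ucvg B ws w ->
  mx_ucvg B (fun m y => riemann_curvature h y (vs m y) z (ws m y))
            (fun y => riemann_curvature h y (v y) z (w y)).
Proof.
move=> Hv Hw a b.
have H := ucvg_sum (index_enum 'I_n) (fun j => ucvg_sum (index_enum 'I_n) (fun k =>
  ucvgM (ucvgM (ucvg_const B (z j 0)) (Hv k 0)) (mx_ucvgM (curv_ucvg j k) Hw a b))).
apply: ucvg_eq H => [m y /BD Dy|y /BD Dy];
  rewrite (riemann_curvatureE Do h_unit h_C2 _ _ _ Dy) summxE;
  by apply: eq_bigr => j _; rewrite summxE; apply: eq_bigr => k _; rewrite [RHS]mxE.
Qed.

Lemma J_poly_ucvg As A vs v ws w r :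
  mx_ucvg B As A -> mx_ucvg B vs v -> mx_ucvg B ws w ->
  ucvg B (fun m y => J_poly h y (As m y) r (vs m y) (ws m y))
         (fun y => J_poly h y (A y) r (v y) (w y)).
Proof.
move=> HA; elim: r vs v => [|r IH] vs v Hv Hw; first exact: ucvg_const.
have [_ HN] := newton_poly_ucvg r HA.
have H1 := ucvg_sum (index_enum 'I_n) (fun j : 'I_n =>
  mx_ucvgM HN (riemann_ucvg (delta_mx j 0) Hv Hw) j 0).
have H2 := ucvgN (IH _ _ (mx_ucvgM HA Hv) Hw).
apply: ucvg_eq (ucvgD H1 H2) => [m y _|y _] /=; congr (_ + _);
  by rewrite /map_trace /mxtrace; apply: eq_bigr => j _; rewrite [RHS]mxE.
Qed.

Lemma div_gE (V : 'rV[R]_n -> 'cV[R]_n) y : div_g h V y =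
  \sum_i partial i (fun z => V z i 0) y + \sum_i (Gam h i y *m V y) i 0.
Proof.
rewrite /div_g /mxtrace -big_split /=; apply: eq_bigr => i _.
by rewrite mxE; congr (_ + _); rewrite mxE; apply: eq_bigr => k _; rewrite mxE.
Qed.

(* X is only C^1, so div (P_r X) makes sense only in the limit of smooth fields
   approximating X in C^1. *)
Lemma div_newton_pointwise (X V : 'rV[R]_n -> 'cV[R]_n) r : mx_C1 D X ->
  (forall y, D y -> V y = newton_poly r (nabla h X y) *m X y) ->
  differentiable V x0 ->
  div_g h V x0 = r.+1%:R * sigma r.+1 (nabla h X x0)
                 - J_poly h x0 (nabla h X x0) r (X x0) (X x0).
Proof.
move=> CX VE dV; pose A := nabla h X.
have [Xs HX] : exists Xs : nat -> 'rV[R]_n -> 'cV[R]_n, forall m,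
    (forall k, class_C 2 B (fun y => Xs m y k 0)) /\
    forall y, B y -> forall k, `|Xs m y k 0 - X y k 0| <= m.+1%:R^-1 /\
      forall j, `|partial j (fun z => Xs m z k 0) y - partial j (fun z => X z k 0) y|
        <= m.+1%:R^-1.
  have Hw (m : nat) : forall k, exists w : 'rV[R]_n -> R, class_C 2 B w /\
      forall y, B y -> `|w y - X y k 0| <= m.+1%:R^-1 /\
      forall j, `|partial j w y - partial j (fun z => X z k 0) y| <= m.+1%:R^-1.
    by move=> k; apply: (class_C2_approx r0h _ (CX k 0)); rewrite invr_gt0 ltr0Sn.
  have [ws Hws] : exists ws : nat -> 'I_n -> 'rV[R]_n -> R, forall m k, class_C 2 B (ws m k) /\
      forall y, B y -> `|ws m k y - X y k 0| <= m.+1%:R^-1 /\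
      forall j, `|partial j (ws m k) y - partial j (fun z => X z k 0) y| <= m.+1%:R^-1.
    have /choice[ws Hws] : forall m, exists w : 'I_n -> 'rV[R]_n -> R,
      forall k, class_C 2 B (w k) /\
      forall y, B y -> `|w k y - X y k 0| <= m.+1%:R^-1 /\
      forall j, `|partial j (w k) y - partial j (fun z => X z k 0) y| <= m.+1%:R^-1.
      by move=> m; have /choice[w Hw'] := Hw m; exists w.
    by exists ws.
  exists (fun m y => \col_k ws m k y) => m.
  have E k : (fun y => (\col_k ws m k y) k 0) = ws m k by apply/funext => y; rewrite mxE.
  split=> [k|y By k]; first by rewrite E; case: (Hws m k).
  by rewrite E mxE; have [_ /(_ y By)] := Hws m k.
have small (eta : R) : 0 < eta -> exists N, forall m, (N <= m)%N -> m.+1%:R^-1 <= eta.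
  move=> eta0; exists (Num.truncn eta^-1) => m Nm.
  rewrite invf_ple ?posrE ?ltr0Sn//; apply: le_trans (ltW (truncnS_gt _)) _.
  by rewrite ler_nat.
have UX : mx_ucvg B Xs X.
  move=> k b; rewrite ord1; have /class_C1E[cX _] := CX k 0.
  have [K [_ HK]] := unif_continuous_bounded r0h cX.
  split; first by exists K.
  move=> eta eta0; have [N HN] := small eta eta0; exists N => m Nm y By.
  by apply: le_trans (HN m Nm); have [_ /(_ y By k)[]] := HX m.
have UdX j : mx_ucvg B (fun m => dmx j (Xs m)) (dmx j X).
  move=> k b; rewrite ord1; have /class_C1E[_ /(_ j)[_ cX]] := CX k 0.
  have [K [_ HK]] := unif_continuous_bounded r0h cX.
  split; first by exists K => y By; rewrite mxE HK.
  move=> eta eta0; have [N HN] := small eta eta0; exists N => m Nm y By.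
  by rewrite !mxE; apply: le_trans (HN m Nm); have [_ /(_ y By k)[_]] := HX m.
have UG j : mx_ucvg B (fun=> Gam h j) (Gam h j).
  by move=> a b; apply: ucvg_C0; exact: Gam_C0.
have UA : mx_ucvg B (fun m => nabla h (Xs m)) A.
  move=> k j; have H := mx_ucvgD (UdX j) (mx_ucvgM (UG j) UX) k 0.
  by apply: ucvg_eq H => [m y _|y _]; rewrite -nablaE mxE.
pose Vs m y : 'cV[R]_n := newton_poly r (nabla h (Xs m) y) *m Xs m y.
have [US _] := newton_poly_ucvg r.+1 UA.
have [_ UN] := newton_poly_ucvg r UA.
have UV := mx_ucvgM UN UX.
(* [divergence_limit] concerns the coordinate divergence, so the Christoffel part of [div_g] is
   subtracted here and restored at the end. *)
pose F y := r.+1%:R * sigma r.+1 (A y) - J_poly h y (A y) r (X y) (X y)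
  - \sum_i (Gam h i y *m (newton_poly r (A y) *m X y)) i 0.
have UF := ucvgD (ucvgD (ucvgM (ucvg_const B r.+1%:R) US) (ucvgN (J_poly_ucvg r UA UX UX)))
  (ucvgN (ucvg_sum (index_enum 'I_n) (fun i => mx_ucvgM (UG i) UV i 0))).
have Bo : open B by exact: ball_open.
have h_C2B a b : class_C 2 B (fun y => h y a b) by exact: class_C_subset BD (h_C2 a b).
have h_symB y : B y -> (h y)^T = h y by move=> /BD; exact: h_sym.
have h_unitB y : B y -> h y \in unitmx by move=> /BD; exact: h_unit.
have CV m : mx_C1 B (Vs m).
  have CA := nabla_C1 Bo h_unitB h_C2B (HX m).1.
  exact: (mx_C1M Bo (newton_poly_C1 Bo r CA).2 (X_C1 (HX m).1)).
have EF m y : B y -> \sum_i partial i (fun z => Vs m z i 0) y =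
    r.+1%:R * sigma r.+1 (nabla h (Xs m) y)
    - J_poly h y (nabla h (Xs m) y) r (Xs m y) (Xs m y)
    - \sum_i (Gam h i y *m Vs m y) i 0.
  move=> By; have := div_newton Bo h_symB h_unitB h_C2B (HX m).1 r By.
  by rewrite div_gE => <-; rewrite addrK.
have UF' : ucvg B (fun m y => \sum_i partial i (fun z => Vs m z i 0) y) F.
  by apply: ucvg_eq UF => [m y By|//]; rewrite EF.
have cF : {for x0, continuous F}.
  apply: (ucvg_continuous _ _ UF'); first by rewrite divr_gt0.
  move=> m; have C1 i := proj2 ((class_C1E _ _).1 (CV m i 0)) i.
  have CS (s : seq 'I_n) :
      class_C0 B (fun y => \sum_(i <- s) partial i (fun z => Vs m z i 0) y).
    elim: s => [|i s IH]; first by under eq_fun do rewrite big_nil; exact: class_C0_cst.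
    under eq_fun do rewrite big_cons.
    exact: (class_C0D (C1 i).2 IH).
  exact: CS.
have bx : D x0 by exact: ballxx.
have r2 : 0 < r0 / 2 by rewrite divr_gt0.
have := divergence_limit r2 dV cF.
rewrite div_gE => ->.
  by rewrite VE// subrK.
move=> eta eta0; have [_ /(_ eta eta0)[N1 HN1]] := UF'.
have /choice[N2 HN2] : forall i, exists N, forall m, (N <= m)%N -> forall y, B y ->
    `|Vs m y i 0 - (newton_poly r (A y) *m X y) i 0| <= eta.
  by move=> i; have [_ /(_ eta eta0)] := UV i 0.
(* A single approximant must serve for the divergence and for all n components. *)
pose m := maxn N1 (\max_i N2 i).
exists (fun i y => Vs m y i 0); split=> [i|y By]; first exact: CV.
split=> [i|]; last by apply: HN1 => //; exact: leq_maxl.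
rewrite VE; last exact: BD.
apply: HN2 => //; apply: leq_trans (leq_maxr _ _).
exact: leq_bigmax.
Qed.

End LocalIdentity.

(** * Return to the eigenvalue definitions and to the manifold *)

Lemma J_J_poly (R : realType) n (h : 'rV[R]_n -> 'M[R]_n) u x s (d : 'I_n -> R)
    (v w : 'cV[R]_n) : (0 < n)%N -> (s <= n)%N ->
  char_poly (shape_operator h u x) = \prod_i ('X - (d i)%:P) ->
  J_ h u s x v w = J_poly h x (shape_operator h u x) s v w.
Proof.
move=> n0 sn Hd; elim: s sn v => [//|s IH] sn v /=.
by rewrite IH ?(ltnW sn)// /tau_ /= (newton_newton_poly n0 (ltnW sn) Hd).
Qed.

Lemma chart_ball (R : realType) n (T : topologicalType) (c : chart R n T) (Om : set T) p :
  open Om -> Om p -> chart_dom c p -> exists2 r : R, 0 < r &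
  ball (chart_coord c p) r `<=` chart_coord c @` (chart_dom c `&` Om).
Proof.
move=> Oo Op cp; set x := chart_coord c p.
have Ix : (chart_coord c @` chart_dom c) x by exists p.
have N1 : nbhs x (chart_coord c @` chart_dom c).
  by apply: open_nbhs_nbhs; split=> //; exact: image_open.
have N2 : nbhs x (chart_param c @^-1` Om).
  apply: (param_continuous Ix); rewrite (coordK cp).
  exact: open_nbhs_nbhs.
have /nbhs_ballP[r /= r0 rN] :
    nbhs x ((chart_coord c @` chart_dom c) `&` (chart_param c @^-1` Om)).
  exact: filterI.
exists r => // y /rN[[q cq <-]]; rewrite /preimage /= (coordK cq) => Oq.
by exists q.
Qed.

Theorem proposition7p1 (R : realType) (n r : nat)
    (M : manifold R n) (g : riemannian_metric M)
    (Om : set M) (u : M -> R)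
    (hr : (1 <= r <= n - 1)%N)
    (Om_open : open Om)
    (u_C2 : class_C_on 2 Om u)
    (p : M) (Om_p : Om p)
    (c : chart R n M) (atlas_c : atlas c) (dom_p : chart_dom c p) :
  let h := fun y : 'rV[R]_n => gram g c (chart_param c y) in
  let uc := u \o chart_param c in
  let x := chart_coord c p in
  let A := shape_operator h uc x in
  let X := grad_over_W h uc x in
  differentiable (newton_grad h uc r) x ->
  r.+1%:R * S_ r.+1 A = r.+1%:R * 'C(n, r.+1)%:R * H_ r.+1 A /\
  r.+1%:R * 'C(n, r.+1)%:R * H_ r.+1 A
    = div_g h (newton_grad h uc r) x + J_ h uc r x X X.
Proof.
move=> h uc x A X dV.
have n0 : (0 < n)%N by lia.
have rn : (r < n)%N by lia.
have SH : r.+1%:R * S_ r.+1 A = r.+1%:R * 'C(n, r.+1)%:R * H_ r.+1 A.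
  rewrite /H_ -mulrA; congr (_ * _).
  by rewrite [RHS]mulrC divfK// pnatr_eq0 -lt0n bin_gt0.
split; rewrite -SH//.
have [r0 r0_gt0 rD] := chart_ball Om_open Om_p dom_p.
have inD y : ball x r0 y -> chart_dom c (chart_param c y).
  by move=> /rD[q [cq _] <-]; rewrite coordK.
have h_sym y : ball x r0 y -> (h y)^T = h y by move=> /inD; exact: gram_sym.
have h_pos y : ball x r0 y -> forall v : 'rV_n, v != 0 -> 0 < (v *m h y *m v^T) 0 0.
  move=> /inD Dy v v0; have := gram_pos g atlas_c Dy (v := v^T).
  by rewrite trmxK trmx_eq0 => /(_ v0).
have h_unit y : ball x r0 y -> h y \in unitmx.
  by move=> Dy; apply: posdef_unitmx; exact: h_pos.
have h_C2 a b : class_C 2 (ball x r0) (fun y => h y a b).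
  apply: class_C_subset (gram_smooth g a b atlas_c 2).
  by move=> y /rD[q [cq _] <-]; exists q.
have uc_C2 : class_C 2 (ball x r0) uc := class_C_subset rD (u_C2 c atlas_c).
have Do : open (ball x r0) by exact: ball_open.
have split_ y : ball x r0 y -> exists d : 'I_n -> R,
    char_poly (shape_operator h uc y) = \prod_i ('X - (d i)%:P).
  exact: (shape_operator_split Do h_sym h_pos h_C2 uc_C2).
have [d Hd] := split_ x (ballxx x r0_gt0).
have CX := grad_over_W_C1 Do h_pos h_C2 uc_C2.
(* The two Newton tensors must agree on a whole ball and not only at x, because the approximants are
   compared with the field near x. *)
have VE y : ball x r0 y ->
    newton_grad h uc r y = newton_poly r (nabla h (grad_over_W h uc) y) *m grad_over_W h uc y.
  move=> Dy; have [e He] := split_ y Dy.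
  by rewrite /newton_grad (newton_newton_poly n0 (ltnW rn) He).
rewrite (div_newton_pointwise r0_gt0 h_sym h_unit h_C2 CX VE dV).
by rewrite (char_poly_sigma n0 rn Hd) (J_J_poly _ _ n0 (ltnW rn) Hd) subrK.
Qed.
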